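(* Let $R>0$, $\beta\ge0$, $p>0$, $d\in\mathbb{N}$ be fixed and consider a sequence of models with noise level $\delta\to0$ and dimension $D=D_\delta\to\infty$ (setting as in the context). Suppose that the filters are $\gamma_i^{(t)}=g(t,\lambda_i)$ with a regulariser $g$ satisfying Assumption (R) with $\rho>1$, that $|\kappa-D\delta^2|\le C_\kappa\sqrt D\,\delta^2$ with $C_\kappa\in[0,C_\circ)$, that $\lambda_i=c_Ai^{-p/d}$ for $c_A>0$ and $p/d>\big(\min(\rho,2\rho-2)\big)^{-1}$, and that $$1-g(t,\lambda)\le C_q(t\lambda)^{-2q},\qquad t\ge t_\circ,\ \lambda\in(0,1],$$ for some qualification index $q>0$ and some constant $C_q$; all the constants $\rho,\beta_-,\beta_+,C_\kappa,C_\circ,c_A,C_q,q$ being independent of $\delta$ and $D$. Assume $2q-1\ge\beta/p$ and that $(R/\delta)^{2d/(2\beta+2p+d)}\ge c\sqrt D$ for some constant $c>0$ independent of $\delta$ and $D$. Then there is a constant $C>0$, independent of $\delta$ and $D$, such that, as $\delta\to0$ (that is, for all sufficiently small $\delta$ in the sequence), $$\sup_{\mu\in H_d^\beta(R)}\mathbb{E}\big[\|\widehat\mu^{(\tau)}-\mu\|^2\big]\le C\,R^2(R^{-1}\delta)^{4\beta/(2\beta+2p+d)}.$$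
   Context: For each noise level $\delta>0$ with dimension $D\in\mathbb{N}$, and numbers $1\ge\lambda_1\ge\dots\ge\lambda_D>0$, and signal $\mu\in\mathbb{R}^D$, one observes $Y_i=\lambda_i\mu_i+\delta\varepsilon_i$, $i=1,\dots,D$, with $\varepsilon_i$ independent standard normal. For filters $\gamma_i^{(t)}\in[0,1]$, $t\ge0$, set $\widehat\mu_i^{(t)}=\gamma_i^{(t)}\lambda_i^{-1}Y_i$. $\|\cdot\|$ is the Euclidean norm. Notation: $R_t^2=\sum_i(1-\gamma_i^{(t)})^2Y_i^2$ (not to be confused with the radius $R$); $V_{t,\lambda}=\delta^2\sum_i(\gamma_i^{(t)})^2$; $t_\circ=\inf\{t\ge0:V_{t,\lambda}=C_\circ D^{1/2}\delta^2\}$ with a constant $C_\circ\ge1$, $C_\circ<D^{1/2}$; for a threshold $\kappa>0$ (which may depend on $\delta$ and $D$), $\tau=\inf\{t\ge t_\circ:R_t^2\le\kappa\}$. Sobolev-type ellipsoid: $H_d^\beta(R)=\{\mu\in\mathbb{R}^D:\sum_{i=1}^Di^{2\beta/d}\mu_i^2\le R^2\}$. Assumption (R) on $g:\mathbb{R}_+\times\mathbb{R}_+\to[0,1]$: (R1) $g(t,\lambda)$ is nondecreasing in $t$ and in $\lambda$, continuous in $t$, with $g(0,\lambda)=0$ and $\lim_{t\to\infty}g(t,\lambda)=1$ for each fixed $\lambda>0$; (R2) for all $t\ge t'\ge t_\circ$ the function $\lambda\mapsto\frac{1-g(t',\lambda)}{1-g(t,\lambda)}$ (values in $[0,\infty]$,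 convention $c/0=+\infty$ for $c\ge0$) is nondecreasing; (R3) there are positive constants $\rho,\beta_-,\beta_+$ such that for all $t\ge t_\circ$ and $\lambda\in(0,1]$: $\beta_-\min((t\lambda)^\rho,1)\le g(t,\lambda)\le\min(\beta_+(t\lambda)^\rho,1)$. *)

(* Defs.v *)
From HB Require Import structures.
From mathcomp Require Import all_boot all_order all_algebra.
From mathcomp Require Import all_classical all_reals all_analysis.

Set Implicit Arguments.
Unset Strict Implicit.
Unset Printing Implicit Defensive.

Import Order.TTheory GRing.Theory Num.Theory.
Import numFieldNormedType.Exports.

Local Open Scope classical_set_scope.
Local Open Scope ring_scope.

(* The library norm on row vectors is the sup norm, hence this definition. *)
Definition enorm (R : realType) (D : nat) (v : 'rV[R]_D) : R :=
  Num.sqrt (\sum_(i < D) v 0 i ^+ 2).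

(* Coordinates are numbered from 0, so that [i.+1] is the index in 1..D. *)
Definition power_spectrum (R : realType) (cA p : R) (d D : nat) : 'rV[R]_D :=
  \row_i (cA * i.+1%:R `^ (- (p / d%:R))).

Definition sobolev_ellipsoid (R : realType) (d D : nat) (beta radius : R) :
    set 'rV[R]_D :=
  [set mu | \sum_(i < D) i.+1%:R `^ (2 * beta / d%:R) * mu 0 i ^+ 2
            <= radius ^+ 2].

Section SpectralEstimation.
Context (R : realType) (D : nat).
Implicit Types (lam mu Y : 'rV[R]_D) (delta kappa t : R).
(* [gam t] is the vector of filters gamma_i^(t). *)
Implicit Type gam : R -> 'rV[R]_D.

Definition observation lam delta mu (noise : 'rV[R]_D) : 'rV[R]_D :=
  \row_i (lam 0 i * mu 0 i + delta * noise 0 i).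

Definition estimator lam gam t Y : 'rV[R]_D :=
  \row_i (gam t 0 i * (lam 0 i)^-1 * Y 0 i).

Definition residual2 gam t Y : R :=
  \sum_(i < D) (1 - gam t 0 i) ^+ 2 * Y 0 i ^+ 2.

Definition weak_variance delta gam t : R :=
  delta ^+ 2 * \sum_(i < D) gam t 0 i ^+ 2.

Definition initial_time delta gam (C0 : R) : R :=
  inf [set t | 0 <= t /\
         weak_variance delta gam t = C0 * Num.sqrt D%:R * delta ^+ 2].

Definition stopping_time delta gam (C0 : R) kappa Y : R :=
  inf [set t | initial_time delta gam C0 <= t /\ residual2 gam t Y <= kappa].

Definition regulariser_filter (g : R -> R -> R) lam t : 'rV[R]_D :=
  \row_i g t (lam 0 i).

End SpectralEstimation.

(* a / b with values in [0, +oo] for a, b >= 0 and a / 0 = +oo, also for a = 0;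
   the library division of extended reals gives 0 / 0 = 0 instead. *)
Definition eratio (R : realType) (a b : R) : \bar R :=
  if b == 0 then +oo%E else (a / b)%:E.

(* A function on R_+ x R_+ is
   encoded as a function on R x R whose values are only constrained on
   nonnegative arguments. *)
Record assumption_R (R : realType) (t0 rho betam betap : R)
    (g : R -> R -> R) : Prop := AssumptionR {
  regR_range : forall (t l : R), 0 <= t -> 0 <= l -> 0 <= g t l <= 1;
  regR1_time : forall (l t' t : R),
    0 <= l -> 0 <= t' -> t' <= t -> g t' l <= g t l;
  regR1_spec : forall (t l' l : R),
    0 <= t -> 0 <= l' -> l' <= l -> g t l' <= g t l;
  regR1_cont : forall (l : R), 0 < l ->
    {within `[0, +oo[, continuous (fun t => g t l)};
  regR1_init : forall (l : R), 0 < l -> g 0 l = 0;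
  regR1_lim : forall (l : R), 0 < l -> g t l @[t --> +oo] --> (1 : R);
  regR2 : forall (t' t l' l : R), t0 <= t' -> t' <= t -> 0 <= l' -> l' <= l ->
    (eratio (1 - g t' l') (1 - g t l') <= eratio (1 - g t' l) (1 - g t l))%E;
  regR3 : forall (t l : R), t0 <= t -> 0 < l <= 1 ->
    betam * Num.min ((t * l) `^ rho) 1 <= g t l
      <= Num.min (betap * (t * l) `^ rho) 1
}.

Definition mutually_independent (R : realType) (disp : measure_display)
    (T : measurableType disp) (P : probability T R) (I : finType)
    (X : I -> {RV P >-> R}) : Prop :=
  forall (J : {set I}) (A : I -> set R), (forall i, measurable (A i)) ->
    P (\bigcap_(i in [set` J]) (X i @^-1` A i)) =
    (\prod_(i in J) P (X i @^-1` A i))%E.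

Definition standard_normal (R : realType) (disp : measure_display)
    (T : measurableType disp) (P : probability T R) (X : {RV P >-> R}) : Prop :=
  forall A : set R, measurable A -> distribution P X A = normal_prob 0 1 A.

Definition stopped_risk (R : realType) (disp : measure_display)
    (T : measurableType disp) (P : probability T R) (D : nat)
    (eps : 'I_D -> {RV P >-> R}) (lam : 'rV[R]_D) (delta : R)
    (gam : R -> 'rV[R]_D) (C0 kappa : R) (mu : 'rV[R]_D) : \bar R :=
  let Y w := observation lam delta mu (\row_i eps i w) in
  let tau w := stopping_time delta gam C0 kappa (Y w) in
  'E_P[fun w => enorm (estimator lam gam (tau w) (Y w) - mu) ^+ 2].

(* Main.v *)
(** Put [L = radius / delta], [xs = L^(2d/m)] with [m = 2 beta + 2 p + d], and
    [ts = xs^(p/d)]: then [delta^2 xs ts^2] is the minimax rate. Splitting the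
    spectrum at [lam = 1/ts] bounds the strong bias at the stopping time [tau] by
    [ts^2] times the weak bias plus a term of the order of the rate, so it suffices
    that the weak bias at [tau] has mean [O(delta^2 xs)] and the stochastic error
    mean [O(delta^2 xs ts^2)].

    If the weak bias at [tau] exceeds [y], then the residual at the deterministic
    time where the weak bias equals [y] is already below [kappa]; if [tau] exceeds
    [t], then the residual at [t] is still above [kappa]. Both events are controlled
    by exponential moments of the residual with parameter [1 / (8 delta^2 sqrt D)]:
    the mean of the residual differs from [kappa] by a multiple of [delta^2 xs], and
    [xs] is at least of order [sqrt D]. Summing over dyadic levels [y], respectively
    dyadic multiples of [xs], gives the two bounds. *)

Require Import Defs.
From HB Require Import structures.
From mathcomp Require Import all_boot all_order all_algebra.
From mathcomp Require Import all_classical all_reals all_analysis.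
From mathcomp Require Import measurable_realfun ring lra.
Import Order.TTheory GRing.Theory Num.Theory.
Import numFieldNormedType.Exports.
Local Open Scope classical_set_scope.
Local Open Scope ring_scope.

Set Implicit Arguments.
Unset Strict Implicit.
Unset Printing Implicit Defensive.

(** * Transfer of integrals *)

Section IntegralTransfer.
Context {R : realType}.
Import HBNNSimple.

(** The stopping time depends on the noise, so neither the bias nor the stochastic error at [tau]
    has an explicit mean. Both are monotone in time, in opposite directions; hence their values at
    deterministic times serve as levels, and passing a level costs only the probability that [tau]
    lies on the wrong side of a fixed time.

    The exponential parameter is dictated by the fluctuations of the residual, which are of order
    [delta^2 sqrt D] from the noise alone. With [1 / (8 delta^2 sqrt D)] the pure noise part of the
    second order term of the exponent is at most [1/16], while a shift [delta^2 xs y] of the mean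
    contributes order [xs y / sqrt D >= c y]. The tails are therefore uniform in [delta] and [D].

    For the stochastic error, a late [tau] is correlated with the squared noise that it lets
    through. The two are separated by a weighted AM-GM inequality, which costs fourth moments and
    asks the tails to decay faster than the amplitudes grow.

    The two-sided bounds on [g] hold only after the initial time, which therefore has to be located
    as well. *)

Lemma integral_weighted_approx d1 d2 (S : measurableType d1)
    (S' : measurableType d2) (mu : {measure set S -> \bar R}) (phi : S -> S')
    (w : S -> R) (f : S' -> R) (mf : measurable_fun (T:=S') setT (EFin \o f)) :
  measurable_fun setT phi -> measurable_fun setT w ->
  (forall x, 0 <= w x) -> (forall y, 0 <= f y) ->
  let fn := nnsfun_approx measurableT mf in
  (\int[mu]_x (w x * f (phi x))%:E =
   limn (fun n => \sum_(k \in range (fn n))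
     (k%:E * \int[mu]_x (w x * \1_(fn n @^-1` [set k]) (phi x))%:E)))%E.
Proof.
move=> mphi mw w0 f0 fn.
have mfn n : measurable_fun setT (fun x => fn n (phi x)).
  by apply: measurableT_comp => //; exact: measurable_funP.
transitivity (limn (fun n => \int[mu]_x (w x * fn n (phi x))%:E))%E.
  rewrite -monotone_convergence//.
  - apply: eq_integral => x _; apply/esym/cvg_lim => //.
    rewrite (_ : (fun n => _) = (fun n => (w x)%:E * (fn n (phi x))%:E)%E);
      last by apply/funext => n; rewrite EFinM.
    rewrite EFinM; apply: cvgeZl => //.
    by apply: (@cvg_nnsfun_approx _ _ _ _ measurableT _ mf) => // y _;
       rewrite lee_fin.
  - by move=> n; exact/measurable_EFinP/measurable_funM.
  - by move=> n x _; rewrite lee_fin mulr_ge0.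
  - move=> x _ m n mn; rewrite lee_fin ler_wpM2l//.
    by apply/lefP/nd_nnsfun_approx.
congr (limn _); apply/funext => n.
have mk (k : R) : measurable_fun setT
    (fun x => w x * \1_(fn n @^-1` [set k]) (phi x)).
  apply: measurable_funM => //.
  by apply: measurableT_comp => //; exact: measurable_indic.
transitivity (\int[mu]_x \sum_(k \in range (fn n))
    (k * (w x * \1_(fn n @^-1` [set k]) (phi x)))%:E)%E.
  apply: eq_integral => x _.
  rewrite [in LHS]fimfunE fsumEFin//; congr EFin; rewrite mulr_fsumr//.
  by apply: eq_fsbigr => k _; rewrite /= mulrCA.
rewrite ge0_integral_fsum//; last 2 first.
- by move=> k; apply/measurable_EFinP; exact: measurable_funM.
- move=> k x _; rewrite mulrCA EFinM mule_ge0 ?lee_fin//.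
  by have := nnfun_muleindic_ge0 (fn n) k (phi x); rewrite lee_fin.
apply: eq_fsbigr => k /[!inE] -[y _ <-].
under eq_integral do rewrite EFinM.
rewrite ge0_integralZl//.
- exact/measurable_EFinP.
- by move=> x _; rewrite lee_fin mulr_ge0.
- by rewrite lee_fin.
Qed.

(** The simple approximations depend on [f] alone, so both integrals are limits over the same level
    sets, where the hypothesis on indicators applies. The weight [v] admits a density on the target
    space; [w] will carry the remaining factors of a product of independent terms. *)
Lemma integral_weighted_transfer d1 d2 (S : measurableType d1)
    (S' : measurableType d2) (mu : {measure set S -> \bar R})
    (nu : {measure set S' -> \bar R}) (phi : S -> S')
    (w : S -> R) (v f : S' -> R) :
  measurable_fun setT phi -> measurable_fun setT w -> measurable_fun setT v ->
  (forall x, 0 <= w x) -> (forall y, 0 <= v y) ->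
  (forall B, measurable B -> (\int[mu]_x (w x * \1_B (phi x))%:E =
                              \int[nu]_y (v y * \1_B y)%:E)%E) ->
  measurable_fun setT f -> (forall y, 0 <= f y) ->
  (\int[mu]_x (w x * f (phi x))%:E = \int[nu]_y (v y * f y)%:E)%E.
Proof.
move=> mphi mw mv w0 v0 wv mf f0.
have mf' : measurable_fun (T:=S') setT (EFin \o f) by exact/measurable_EFinP.
rewrite (integral_weighted_approx mu mf' mphi mw w0 f0).
rewrite (integral_weighted_approx nu mf' (@measurable_id _ S' setT) mv v0 f0).
congr (limn _); apply/funext => n; apply: eq_fsbigr => k _.
by rewrite wv// -[X in measurable X]setTI; exact: measurable_funP.
Qed.

End IntegralTransfer.

(** * Product formula under independence *)

Section Independence.
Context {R : realType} {disp : measure_display} {T : measurableType disp}.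
Context {P : probability T R} {I : finType} (X : I -> {RV P >-> R}).

Lemma measurable_RV_preimage (i : I) (B : set R) :
  measurable B -> measurable (X i @^-1` B).
Proof. by move=> mB; rewrite -[X in measurable X]setTI; exact: measurable_funPT. Qed.

Lemma measurable_RV_bigcap (J : {set I}) (A : I -> set R) :
  (forall i, measurable (A i)) ->
  measurable (\bigcap_(i in [set` J]) (X i @^-1` A i)).
Proof.
move=> mA; apply: fin_bigcap_measurable; first exact: finite_finset.
by move=> i _; exact: measurable_RV_preimage.
Qed.

Lemma measurable_prod_RV (s : seq I) (f : I -> R -> R) :
  (forall i, measurable_fun setT (f i)) ->
  measurable_fun setT (fun x => \prod_(i <- s) f i (X i x)).
Proof.
move=> mf; apply: measurable_prod => i _.
by apply: measurableT_comp => //; exact: measurable_funPT.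
Qed.

Hypothesis indepX : mutually_independent X.

(* The induction on [s] replaces, one coordinate at a time, the indicators of the
   independence hypothesis by arbitrary nonnegative functions. *)
Lemma integral_prod_indic (f : I -> R -> R) (m : I -> R) :
  (forall i, measurable_fun setT (f i)) -> (forall i y, 0 <= f i y) ->
  (forall i, \int[P]_x (f i (X i x))%:E = (m i)%:E)%E ->
  forall (s : seq I) (J : {set I}) (A : I -> set R), uniq s ->
  (forall i, i \in s -> i \notin J) -> (forall i, measurable (A i)) ->
  (\int[P]_x (\prod_(i <- s) f i (X i x) *
      \1_(\bigcap_(i in [set` J]) (X i @^-1` A i)) x)%:E =
   (\prod_(i <- s) m i * \prod_(i in J) fine (P (X i @^-1` A i)))%:E)%E.
Proof.
move=> mf f0 fm.
have m0 i : 0 <= m i.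
  by rewrite -lee_fin -fm; apply: integral_ge0 => x _; rewrite lee_fin.
elim=> [|k s IH] J A us sJ mA.
  under eq_integral do rewrite big_nil mul1r.
  rewrite big_nil mul1r integral_indic//; last exact: measurable_RV_bigcap.
  rewrite setIT -prodEFin; etransitivity; first exact: (indepX J mA).
  apply: eq_bigr => i _.
  by rewrite fineK// fin_num_measure//; exact: measurable_RV_preimage.
move: us => /= /andP[ks us].
have sJ' i : i \in s -> i \notin J by move=> si; apply: sJ; rewrite inE si orbT.
have kJ : k \notin J by apply: sJ; rewrite mem_head.
pose w x := \prod_(i <- s) f i (X i x) *
  \1_(\bigcap_(i in [set` J]) (X i @^-1` A i)) x : R.
pose c := \prod_(i <- s) m i * \prod_(i in J) fine (P (X i @^-1` A i)).
have c0 : 0 <= c.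
  by rewrite mulr_ge0 ?prodr_ge0// => i _; rewrite ?fine_ge0.
have := @integral_weighted_transfer R _ _ _ _ P (distribution P (X k))
  (X k) w (cst c) (f k) (@measurable_funPT _ _ _ _ (X k)).
have mw : measurable_fun setT w.
  apply: measurable_funM; first exact: measurable_prod_RV.
  by apply: measurable_indic; exact: measurable_RV_bigcap.
move=> /(_ mw (measurable_cst _)) transfer.
transitivity (\int[P]_x (w x * f k (X k x))%:E)%E.
  apply: eq_integral => x _; congr EFin.
  by rewrite big_cons /w mulrC mulrCA mulrA mulrC !mulrA; ring.
rewrite transfer//.
- under eq_integral do rewrite /= EFinM.
  rewrite ge0_integralZl//.
  + rewrite ge0_integral_pushforward//.
    * rewrite preimage_setT.
      rewrite [X in (_ * X)%E](_ : _ = (m k)%:E)%E; last by rewrite -fm.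
      by rewrite -EFinM big_cons /c mulrC mulrA.
    * exact/measurable_EFinP.
    * by move=> y _; rewrite lee_fin.
  + exact/measurable_EFinP.
  + by move=> y _; rewrite lee_fin.
- move=> x; rewrite mulr_ge0 ?prodr_ge0//.
- move=> B mB.
  (* Membership of [X k] in [B] joins the intersection, so the induction hypothesis for [k |: J]
     evaluates the weighted indicator. *)
  pose A' i := if i == k then B else A i.
  have AA' i : i \in J -> A' i = A i.
    by rewrite /A'; case: eqP => // -> kJ'; rewrite kJ' in kJ.
  transitivity (\int[P]_x (\prod_(i <- s) f i (X i x) *
      \1_(\bigcap_(i in [set` k |: J]) (X i @^-1` A' i)) x)%:E)%E.
    apply: eq_integral => x _; rewrite /w -mulrA; congr (_ * _)%:E.
    rewrite !indicE -natrM mulnb; congr (_%:R); congr nat_of_bool.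
    apply/andP/idP; rewrite !inE.
      move=> [JA XB] i /=; rewrite in_setU1 => /orP[/eqP ->|iJ].
        by rewrite /A' eqxx.
      by rewrite AA'//; apply: JA.
    move=> h; split.
      by move=> i /= iJ; rewrite -(AA' i iJ); apply: h; rewrite /= in_setU1 iJ orbT.
    by have /= := h k; rewrite /A' eqxx; apply; rewrite in_setU1 eqxx.
  rewrite IH//.
  + rewrite big_setU1//= (_ : A' k = B); last by rewrite /A' eqxx.
    have -> : \prod_(i in J) fine (P (X i @^-1` A' i)) =
        \prod_(i in J) fine (P (X i @^-1` A i)).
      by apply: eq_bigr => i iJ; rewrite AA'.
    rewrite mulrCA mulrC.
    under [RHS]eq_integral do rewrite /= EFinM.
    rewrite ge0_integralZl//.
    * by rewrite integral_indic//= setIT EFinM fineK// fin_num_measure//;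
        exact: measurable_RV_preimage.
    * by apply/measurable_EFinP; exact: measurable_indic.
  + move=> i si; rewrite in_setU1 negb_or sJ'// andbT.
    by apply: contraNneq ks => <-.
  + by move=> i; rewrite /A'; case: ifP.
Qed.

Lemma integral_prod_independent (f : I -> R -> R) (m : I -> R) :
  (forall i, measurable_fun setT (f i)) -> (forall i y, 0 <= f i y) ->
  (forall i, \int[P]_x (f i (X i x))%:E = (m i)%:E)%E ->
  (\int[P]_x (\prod_i f i (X i x))%:E = (\prod_i m i)%:E)%E.
Proof.
move=> mf f0 fm.
have disj0 i : i \in index_enum I -> i \notin finset.set0 by rewrite finset.in_set0.
have := integral_prod_indic mf f0 fm (A := fun=> setT)
  (index_enum_uniq I) disj0 (fun=> measurableT).
rewrite big_set0 mulr1 => <-.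
apply: eq_integral => x _; rewrite indicE mem_set ?mulr1//.
Qed.

End Independence.

(** * Exponential moments of a standard normal variable *)

Section StandardNormal.
Context {R : realType} {disp : measure_display} {T : measurableType disp}.
Context {P : probability T R} (X : {RV P >-> R}).
Hypothesis normalX : standard_normal X.

Lemma integral_standard_normal (f : R -> R) :
  measurable_fun setT f -> (forall y, 0 <= f y) ->
  (\int[P]_x (f (X x))%:E =
   \int[lebesgue_measure]_y (normal_pdf 0 1 y * f y)%:E)%E.
Proof.
move=> mf f0.
rewrite -(@integral_weighted_transfer R _ _ _ _ P lebesgue_measure X (cst 1)
  (normal_pdf 0 1) f (@measurable_funPT _ _ _ _ X))//.
- by apply: eq_integral => x _; rewrite /= mul1r.
- exact: measurable_normal_pdf.
- by move=> y; exact: normal_pdf_ge0.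
- move=> B mB; have := normalX mB; rewrite /distribution /pushforward => PB.
  under eq_integral do rewrite /= mul1r.
  rewrite [LHS](integral_indic P measurableT (A := X @^-1` B)); last first.
    by rewrite -[X in measurable X]setTI; exact: measurable_funPT.
  rewrite setIT [LHS]PB /normal_prob [LHS]integral_mkcond.
  apply: eq_integral => y _; rewrite patchE indicE.
  by case: ifPn => yB; rewrite ?mulr1 ?mulr0.
Qed.

(** Completing the square: the tilted density is, up to a factor, Gaussian of mean [2 s a b / w] and
    variance [1 / w], so its integral can be read off. *)
Lemma normal_pdf_exp_quadratic (s a b y : R) : 0 < 1 - 2 * (s * a ^+ 2) ->
  let w := 1 - 2 * (s * a ^+ 2) in let sg := Num.sqrt w^-1 in
  normal_pdf 0 1 y * expR (s * (a * y + b) ^+ 2) =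
  sg * expR (s * b ^+ 2 + 2 * (s * a * b) ^+ 2 / w) *
  normal_pdf (2 * s * a * b / w) sg y.
Proof.
move=> w0 w sg; have wv0 : 0 < w^-1 by rewrite invr_gt0.
have sg0 : 0 < sg by rewrite sqrtr_gt0.
have sg2 : sg ^+ 2 = w^-1 by rewrite sqr_sqrtr// ltW.
rewrite !normal_pdfE ?oner_eq0 ?gt_eqF//= /normal_peak /normal_fun.
have -> : (Num.sqrt (1 ^+ 2 * pi *+ 2))^-1 =
    sg * (Num.sqrt (sg ^+ 2 * pi *+ 2))^-1 :> R.
  rewrite expr1n mul1r -mulrnAr sqrtrM ?sqr_ge0// sqrtr_sqr gtr0_norm//.
  by rewrite invfM mulrA mulfV ?mul1r// gt_eqF.
rewrite -!mulrA; congr (_ * _); rewrite [RHS]mulrCA -!expRD.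
congr (_ * expR _); rewrite sg2 /w.
have w1 : w != 0 by rewrite gt_eqF.
have : 1 - 2 * (s * a ^+ 2) != 0 by [].
by move=> h; field; rewrite -?mulr2n ?h ?oner_eq0.
Qed.

(** The exponent is [s] times the mean of the square plus a remainder quadratic in [s]. Both signs
    of [s] are covered, for upper and lower deviations. *)
Lemma integral_exp_quadratic (s a b : R) : `|s| * a ^+ 2 <= 4^-1 ->
  exists2 m : R, (\int[P]_x (expR (s * (a * X x + b) ^+ 2))%:E = m%:E)%E &
    m <= expR (s * (a ^+ 2 + b ^+ 2) +
               4 * s ^+ 2 * (a ^+ 4 + a ^+ 2 * b ^+ 2)).
Proof.
move=> sa; set v := s * a ^+ 2.
have v4 : - 4^-1 <= v <= 4^-1.
  by rewrite -ler_norml normrM [`|a ^+ 2|]ger0_norm ?sqr_ge0.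
set w := 1 - 2 * v; set sg := Num.sqrt w^-1.
have w2 : 2^-1 <= w by rewrite /w; lra.
have w0 : 0 < w by apply: lt_le_trans w2; rewrite invr_gt0.
have wv2 : w^-1 <= 2 by rewrite invf_ple ?posrE// ltr0n.
exists (sg * expR (s * b ^+ 2 + 2 * (s * a * b) ^+ 2 / w)).
  rewrite (@integral_standard_normal (fun y => expR (s * (a * y + b) ^+ 2)))//;
    last first.
    apply: measurableT_comp => //; apply: measurable_funM => //.
    apply: measurable_funX; apply: measurable_funD => //.
  under eq_integral do rewrite normal_pdf_exp_quadratic// EFinM.
  rewrite ge0_integralZl//.
  - by rewrite integral_normal_pdf mule1.
  - by apply/measurable_EFinP; exact: measurable_normal_pdf.
  - by move=> y _; rewrite lee_fin normal_pdf_ge0.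
(* Since [v <= 1/4], [(1 + 2 v + 8 v^2) (1 - 2 v) = 1 + 4 v^2 (1 - 4 v) >= 1], hence
   [1 / w <= exp (2 v + 8 v^2)]. *)
have sg_le : sg <= expR (v + 4 * v ^+ 2).
  rewrite -[leRHS]gtr0_norm ?expR_gt0// -sqrtr_sqr ler_wsqrtr//.
  rewrite -expRM_natl; apply: le_trans (expR_ge1Dx _).
  rewrite -(ler_pM2r w0) mulVf ?gt_eqF//.
  rewrite /w; have := sqr_ge0 v; nra.
apply: le_trans (ler_wpM2r (expR_ge0 _) sg_le) _.
rewrite -expRD ler_expR.
have -> : s * (a ^+ 2 + b ^+ 2) + 4 * s ^+ 2 * (a ^+ 4 + a ^+ 2 * b ^+ 2) =
  v + 4 * v ^+ 2 + (s * b ^+ 2 + 4 * (s * a * b) ^+ 2) by rewrite /v; ring.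
rewrite lerD2l lerD2l; have := sqr_ge0 (s * a * b); nra.
Qed.

(** Extreme admissible case of the quadratic bound, with exponent [1/4 + 1/4]. Second and fourth
    moments are dominated through this one integral, which is the origin of the factors
    [expR 2^-1]. *)
Lemma integral_exp_quarter_sqr :
  (\int[P]_x (expR (X x ^+ 2 / 4))%:E <= (expR 2^-1)%:E)%E.
Proof.
have [|m mE mle] := @integral_exp_quadratic 4^-1 1 0.
  by rewrite expr1n mulr1 ger0_norm.
rewrite (eq_integral (fun x => (expR (4^-1 * (1 * X x + 0) ^+ 2))%:E)); last first.
  by move=> x _; rewrite mul1r addr0 mulrC.
rewrite mE lee_fin (le_trans mle)// ler_expR; lra.
Qed.

End StandardNormal.

Lemma expr4_le_exp (R : realType) (x : R) : x ^+ 4 <= 32 * expR (x ^+ 2 / 4).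
Proof.
have x0 : 0 <= x ^+ 2 / 4 by rewrite divr_ge0 ?sqr_ge0.
have := expR_ge1Dxn 1 x0; rewrite (_ : 2`!%:R = 2) //; lra.
Qed.

(** * Upper bounds on means *)

Section MeanBound.
Import HBNNSimple.
Context {R : realType} {disp : measure_display} {T : measurableType disp}.
Context {P : probability T R}.
Implicit Types (f h : T -> R) (c k : R).

(* An upper bound on the outer expectation of [f]; it spares all measurability
   questions about quantities evaluated at the stopping time. *)
Definition mean_le f c := exists h : T -> R, [/\ measurable_fun setT h,
  (forall x, 0 <= h x), (forall x, f x <= h x) &
  (\int[P]_x (h x)%:E <= c%:E)%E].

(** The integral of a nonnegative function is a supremum over simple functions below it, hence
    monotone even if [f] is not measurable. *)
Lemma mean_le_expectation f c : (forall x, 0 <= f x) -> mean_le f c ->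
  ('E_P[f] <= c%:E)%E.
Proof.
move=> f0 [h [mh h0 fh hc]]; rewrite unlock; apply: le_trans hc.
rewrite !ge0_integralE//; [|by move=> x _; rewrite lee_fin..].
apply: ereal_sup_le => _ [s /= sf <-]; exists s => //= x; apply: le_trans (sf x) _.
by rewrite !patchE; case: ifP => // _; rewrite lee_fin.
Qed.

Lemma mean_le_weaken f f' c c' :
  (forall x, f' x <= f x) -> c <= c' -> mean_le f c -> mean_le f' c'.
Proof.
move=> ff cc [h [mh h0 fh hc]]; exists h; split=> //.
  by move=> x; exact: le_trans (ff x) (fh x).
by apply: le_trans hc _; rewrite lee_fin.
Qed.

Lemma mean_le_cst c : 0 <= c -> mean_le (cst c) c.
Proof.
move=> c0; exists (cst c); split=> //.
have -> : (\int[P]_x c%:E = c%:E * P setT)%E by exact: integral_cst.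
by rewrite -[leRHS]mule1 lee_wpmul2l ?lee_fin// probability_le1.
Qed.

Lemma mean_leD f f' c c' :
  mean_le f c -> mean_le f' c' -> mean_le (fun x => f x + f' x) (c + c').
Proof.
move=> [h [mh h0 fh hc]] [h' [mh' h0' fh' hc']].
exists (fun x => h x + h' x); split=> //.
- exact: measurable_funD.
- by move=> x; rewrite addr_ge0.
- by move=> x; rewrite lerD.
- under eq_integral do rewrite EFinD.
  rewrite ge0_integralD//;
    do ?[exact/measurable_EFinP | by move=> x _; rewrite lee_fin].
  by rewrite EFinD leeD.
Qed.

Lemma mean_leZ k f c : 0 <= k -> mean_le f c ->
  mean_le (fun x => k * f x) (k * c).
Proof.
move=> k0 [h [mh h0 fh hc]]; exists (fun x => k * h x); split=> //.
- exact: measurable_funM.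
- by move=> x; rewrite mulr_ge0.
- by move=> x; rewrite ler_wpM2l.
- under eq_integral do rewrite EFinM.
  rewrite ge0_integralZl//;
    do ?[exact/measurable_EFinP | by move=> x _; rewrite lee_fin].
  by rewrite EFinM lee_wpmul2l.
Qed.

Lemma mean_le_sum (I : Type) (s : seq I) (f : I -> T -> R) (c : I -> R) :
  (forall i, mean_le (f i) (c i)) ->
  mean_le (fun x => \sum_(i <- s) f i x) (\sum_(i <- s) c i).
Proof.
move=> fc; elim: s => [|i s IH].
  rewrite big_nil; apply: mean_le_weaken (mean_le_cst (lexx 0)) => // x.
  by rewrite big_nil.
rewrite big_cons; apply: mean_le_weaken (mean_leD (fc i) IH) => // x.
by rewrite big_cons.
Qed.

End MeanBound.
Arguments mean_le {R disp T} P f c.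

(** * Moments of the noise vector *)

Section GaussianVector.
Context {R : realType} {disp : measure_display} {T : measurableType disp}.
Context {P : probability T R} {D : nat} (eps : 'I_D -> {RV P >-> R}).
Hypothesis indep : mutually_independent eps.
Hypothesis normal : forall i, standard_normal (eps i).

(** Independence reduces this to the one-dimensional moments; [k] makes room for the threshold
    subtracted from the residual. *)
Lemma mean_exp_sum_sqr (a b : 'I_D -> R) (s k : R) :
  (forall i, `|s| * a i ^+ 2 <= 4^-1) ->
  mean_le P (fun x => expR (s * (\sum_i (a i * eps i x + b i) ^+ 2) + k))
    (expR (s * (\sum_i (a i ^+ 2 + b i ^+ 2)) +
      4 * s ^+ 2 * (\sum_i (a i ^+ 4 + a i ^+ 2 * b i ^+ 2)) + k)).
Proof.
move=> sa.
pose g i y := expR (s * (a i * y + b i) ^+ 2).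
have mg i : measurable_fun setT (g i).
  apply: measurableT_comp => //; apply: measurable_funM => //.
  by apply: measurable_funX; apply: measurable_funD.
have gm i : exists m : R, (\int[P]_x (g i (eps i x))%:E = m%:E)%E /\
    m <= expR (s * (a i ^+ 2 + b i ^+ 2) +
               4 * s ^+ 2 * (a i ^+ 4 + a i ^+ 2 * b i ^+ 2)).
  by have [m] := integral_exp_quadratic (normal i) (b i) (sa i); exists m.
have [m mE] := choice gm.
have Pm := integral_prod_independent indep mg (fun i y => expR_ge0 _)
  (fun i => (mE i).1).
have m0 i : 0 <= m i.
  by rewrite -lee_fin -(mE i).1; apply: integral_ge0 => x _; rewrite lee_fin expR_ge0.
have -> : (fun x => expR (s * (\sum_i (a i * eps i x + b i) ^+ 2) + k)) =
    (fun x => expR k * \prod_i g i (eps i x)).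
  apply/funext => x; rewrite addrC expRD mulr_sumr; congr (_ * _).
  exact: (big_morph _ (@expRD R) (@expR0 R)).
rewrite addrC expRD; apply: mean_leZ; first exact: expR_ge0.
exists (fun x => \prod_i g i (eps i x)); split=> //.
- exact: measurable_prod_RV.
- by move=> x; apply: prodr_ge0 => i _; exact: expR_ge0.
- rewrite Pm lee_fin !mulr_sumr -big_split/=.
  rewrite (big_morph _ (@expRD R) (@expR0 R)); apply: ler_prod => i _.
  by rewrite m0 (mE i).2.
Qed.

Lemma mean_sqr_normal i : mean_le P (fun x => eps i x ^+ 2) (4 * expR 2^-1).
Proof.
exists (fun x => 4 * expR (eps i x ^+ 2 / 4)); split.
- apply: measurable_funM => //; apply: measurableT_comp => //.
  by apply: measurable_funM => //; apply: measurable_funX; exact: measurable_funPT.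
- by move=> x; rewrite mulr_ge0// expR_ge0.
- by move=> x; have := expR_ge1Dx (eps i x ^+ 2 / 4); lra.
- under eq_integral do rewrite EFinM.
  rewrite ge0_integralZl//.
  + by rewrite EFinM lee_wpmul2l//; exact: integral_exp_quarter_sqr (normal i).
  + apply/measurable_EFinP; apply: measurableT_comp => //.
    by apply: measurable_funM => //; apply: measurable_funX; exact: measurable_funPT.
Qed.

Lemma mean_expr4_normal i : mean_le P (fun x => eps i x ^+ 4) (32 * expR 2^-1).
Proof.
exists (fun x => 32 * expR (eps i x ^+ 2 / 4)); split.
- apply: measurable_funM => //; apply: measurableT_comp => //.
  by apply: measurable_funM => //; apply: measurable_funX; exact: measurable_funPT.
- by move=> x; rewrite mulr_ge0// expR_ge0.
- by move=> x; exact: expr4_le_exp.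
- under eq_integral do rewrite EFinM.
  rewrite ge0_integralZl//.
  + by rewrite EFinM lee_wpmul2l//; exact: integral_exp_quarter_sqr (normal i).
  + apply/measurable_EFinP; apply: measurableT_comp => //.
    by apply: measurable_funM => //; apply: measurable_funX; exact: measurable_funPT.
Qed.

End GaussianVector.

(** * Sums of powers *)

Section PowerSums.
Context {R : realType}.
Implicit Types (a b x y t : R) (D : nat).

(** After division by [y^(-b)] this is [1 + b / y <= (1 - 1/y)^(-b)], which follows from
    [ln (1 - 1/y) <= - 1/y] and [1 + z <= exp z]. *)
Lemma powR_telescope b y : 0 < b -> 1 < y ->
  b * y `^ (- (b + 1)) + y `^ (- b) <= (y - 1) `^ (- b).
Proof.
move=> b0 y1; have y0 : 0 < y by exact: lt_trans y1.
have z0 : 0 < 1 - y^-1 by rewrite subr_gt0 invf_lt1.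
have -> : y - 1 = y * (1 - y^-1) by rewrite mulrBr mulr1 mulfV// gt_eqF.
rewrite (powRM _ (ltW y0) (ltW z0)) opprD powRD; last first.
  by rewrite (gt_eqF y0) implybT.
rewrite powR_inv1 ?(ltW y0)// mulrCA -[X in _ + X]mulr1 -mulrDr.
rewrite ler_wpM2l ?powR_ge0//.
rewrite /powR gt_eqF//; apply: le_trans (expR_ge1Dx _).
have := @le_ln1Dx R (- y^-1); rewrite ltrN2 invf_lt1// => /(_ y1) h.
have : b * ln (1 - y^-1) <= b * - y^-1 by rewrite ler_pM2l.
lra.
Qed.

Definition min_powR_const a : R := 2 `^ a / (a - 1).

(** Both branches of the minimum at index [k] are at most [2^a (x / (x + k))^a], and the sum of
    these telescopes uniformly in [D]. *)
Lemma sum_min_powR a x D : 1 < a -> 0 < x ->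
  \sum_(i < D) Num.min 1 ((x / i.+1%:R) `^ a) <= min_powR_const a * x.
Proof.
move=> a1 x0; have a0 : 0 < a by exact: lt_trans a1.
have b0 : 0 < a - 1 by rewrite subr_gt0.
(* Up to sign a primitive in [i] of [(x / (x + i))^a]; its value [x / (a - 1)] at 0 bounds the
   telescoped sum. *)
pose h (i : nat) := x `^ a * (x + i%:R) `^ (- (a - 1)) / (a - 1).
have h_ge0 i : 0 <= h i by rewrite divr_ge0 ?mulr_ge0 ?powR_ge0 ?ltW.
have step (i : nat) : Num.min 1 ((x / i.+1%:R) `^ a) <= 2 `^ a * (h i - h i.+1).
  have k0 : 0 < i.+1%:R :> R by rewrite ltr0n.
  have xk0 : 0 < x + i.+1%:R by rewrite addr_gt0.
  apply: (@le_trans _ _ (2 `^ a * (x / (x + i.+1%:R)) `^ a)).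
    rewrite -powRM ?ler0n ?divr_ge0 ?(ltW x0) ?(ltW xk0)//.
    rewrite ge_min; case: (leP i.+1%:R x) => kx; apply/orP; [left|right].
      have one : 1 `^ a = 1 :> R by rewrite powR1.
      rewrite -[leLHS]one ge0_ler_powR ?nnegrE ?(ltW a0)//.
        by rewrite !mulr_ge0 ?invr_ge0 ?(ltW x0) ?(ltW xk0).
      by rewrite mulrA ler_pdivlMr// mul1r; lra.
    rewrite ge0_ler_powR ?nnegrE ?(ltW a0)//.
    - by rewrite divr_ge0 ?(ltW x0) ?(ltW k0).
    - by rewrite !mulr_ge0 ?invr_ge0 ?(ltW x0) ?(ltW xk0).
    - rewrite mulrCA ler_pM2l// -div1r ler_pdivrMr// mulrAC ler_pdivlMr//; lra.
  rewrite ler_wpM2l ?powR_ge0// /h -mulrBl ler_pdivlMr// -mulrBr.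
  rewrite powRM ?invr_ge0 ?(ltW x0) ?(ltW xk0)// -mulrA ler_wpM2l ?powR_ge0//.
  rewrite -[(x + _)^-1]powR_inv1 ?(ltW xk0)// -powRrM mulN1r.
  have y1 : x + i.+1%:R = x + i%:R + 1 by rewrite -natr1 addrA.
  have := @powR_telescope (a - 1) (x + i.+1%:R) b0.
  have e1 : x + i.+1%:R - 1 = x + i%:R by rewrite y1 addrK.
  rewrite subrK e1 => T.
  have [xi|xi] := ltP 1 (x + i.+1%:R); first by have := T xi; lra.
  by exfalso; move: xi; rewrite y1; have := ler0n R i; lra.
apply: (@le_trans _ _ (\sum_(i < D) 2 `^ a * (h i - h i.+1))).
  by apply: ler_sum => i _; exact: step.
rewrite -mulr_sumr -(big_mkord xpredT (fun i => h i - h i.+1)).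
rewrite -(@eq_big_nat _ _ _ _ _ (fun i => - (h i.+1 - h i))); last first.
  by move=> i _; rewrite opprB.
rewrite sumrN telescope_sumr// opprB /min_powR_const -!mulrA.
rewrite ler_wpM2l ?powR_ge0//.
apply: (@le_trans _ _ (h 0%N)); first by rewrite lerBlDr lerDl.
rewrite /h addr0 -powRD; last by rewrite (gt_eqF x0) implybT.
by rewrite opprB addrCA subrr addr0 powRr1 ?(ltW x0)// mulrC.
Qed.

(** Since [y >= 1], the integer part of [y] is at least [y / 2]. *)
Lemma sum_count_ge y D : 1 <= y -> (0 < D)%N ->
  Num.min y D%:R / 2 <= \sum_(i < D) (if i.+1%:R <= y then 1 else 0).
Proof.
move=> y1 D0; have y0 : 0 <= y by exact: le_trans y1.
have -> : \sum_(i < D) (if i.+1%:R <= y then 1 else 0) =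
    (minn (Num.truncn y) D)%:R :> R.
  elim: {D0} D => [|D IH]; first by rewrite big_ord0 minn0.
  rewrite big_ord_recr/= IH -truncn_ge_nat//.
  case: ltnP => h.
    by rewrite !(minn_idPr _) ?(ltnW h)// -natr1.
  by rewrite addr0 !(minn_idPl _)// (leq_trans h).
have ty : 1 <= (Num.truncn y)%:R :> R by rewrite ler1n truncn_ge_nat.
have yt := truncnS_gt y; rewrite -natr1 in yt.
have D1 : 1 <= D%:R :> R by rewrite ler1n.
rewrite ler_pdivrMr// ge_min /minn; case: ifP => _; apply/orP; [left|right]; lra.
Qed.

End PowerSums.

(** * Spectral estimates *)

Section Spectrum.
Context {R : realType} (cA p beta : R) (d D : nat).
Hypotheses (cA_bnd : 0 < cA <= 1) (p_gt0 : 0 < p) (d_gt0 : (0 < d)%N).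
Hypothesis beta_ge0 : 0 <= beta.
Implicit Types (t x r : R) (i : 'I_D) (gam mu : 'rV[R]_D).

Local Notation s := (p / d%:R).
Local Notation theta := (beta / p).
Local Notation lam := (power_spectrum cA p d D).

Let d0 : 0 < d%:R :> R. Proof. by rewrite ltr0n. Qed.
Let s0 : 0 < s. Proof. by rewrite divr_gt0. Qed.
Let cA0 : 0 < cA. Proof. by case/andP: cA_bnd. Qed.
Let theta0 : 0 <= theta. Proof. by rewrite divr_ge0// ltW. Qed.

Lemma spectrum_gt0 i : 0 < lam 0 i.
Proof. by rewrite mxE mulr_gt0// powR_gt0. Qed.

Lemma spectrum_le1 i : lam 0 i <= 1.
Proof.
rewrite mxE mulr_ile1 ?powR_ge0 ?(ltW cA0)//; first by case/andP: cA_bnd.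
by rewrite powRN invf_le1 ?powR_gt0// -[leLHS](powRr0 i.+1%:R) ler_powR ?ler1n ?ltW.
Qed.

(** The reason for writing times as [x^s]: up to constants, [x] is the index at which time times
    eigenvalue is 1, an effective dimension. *)
Lemma spectrum_scaledE x i : 0 < x ->
  x `^ s * lam 0 i = cA * (x / i.+1%:R) `^ s.
Proof.
move=> x0; rewrite mxE mulrCA powRM ?(ltW x0)//.
by rewrite -[i.+1%:R^-1]powR_inv1// -powRrM mulN1r.
Qed.

Lemma sum_min_spectrum x r : 0 < x -> 1 < s * r ->
  \sum_i Num.min 1 ((x `^ s * lam 0 i) `^ r) <= min_powR_const (s * r) * x.
Proof.
move=> x0 sr; apply: le_trans (sum_min_powR D sr x0).
have r0 : 0 < r by rewrite -(pmulr_rgt0 _ s0) (lt_trans _ sr).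
apply: ler_sum => i _; rewrite le_min2//.
rewrite spectrum_scaledE// [leRHS]powRrM ge0_ler_powR ?nnegrE ?powR_ge0 ?(ltW r0)//.
  by rewrite mulr_ge0 ?powR_ge0 ?ltW.
by rewrite ler_piMl ?powR_ge0//; case/andP: cA_bnd.
Qed.

(** At indices up to [cA^(1/s) x], time times eigenvalue is at least 1 and the filter at least
    [betam]; these indices are counted. The power 2 locates the initial time, the power 1 controls
    the mean of the residual. *)
Lemma sum_expr_filter_ge x betam rho gam k : 0 < x -> 0 < betam -> 0 <= rho ->
  (forall i, betam * Num.min ((x `^ s * lam 0 i) `^ rho) 1 <= gam 0 i) ->
  1 <= cA `^ s^-1 * x -> (0 < D)%N ->
  betam ^+ k * (Num.min (cA `^ s^-1 * x) D%:R / 2) <= \sum_i gam 0 i ^+ k.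
Proof.
move=> x0 b0 rho0 hg y1 D0; have := sum_count_ge y1 D0.
rewrite -(ler_pM2l (exprn_gt0 k b0)) => /le_trans; apply.
rewrite mulr_sumr; apply: ler_sum => i _.
have g0 : 0 <= gam 0 i.
  by apply: le_trans (hg i); rewrite mulr_ge0 ?(ltW b0)// le_min powR_ge0 ler01.
case: ifPn => iy; last by rewrite mulr0 exprn_ge0.
rewrite mulr1 lerXn2r ?nnegrE ?(ltW b0)//.
apply: le_trans (hg i); rewrite ler_peMr ?(ltW b0)// le_min lexx andbT.
have one q : 1 `^ q = 1 :> R by rewrite powR1.
rewrite -[leLHS](one rho) ge0_ler_powR ?nnegrE ?ler01//.
  by rewrite mulr_ge0 ?powR_ge0 ?(ltW (spectrum_gt0 _)).
rewrite spectrum_scaledE//.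
have -> : cA = (cA `^ s^-1) `^ s by rewrite -powRrM mulVf ?gt_eqF// powRr1 ?ltW.
rewrite -powRM ?powR_ge0 ?divr_ge0 ?(ltW x0)// -[leLHS](one s).
rewrite ge0_ler_powR ?nnegrE ?ler01 ?(ltW s0)//.
  by rewrite mulr_ge0 ?powR_ge0 ?divr_ge0 ?(ltW x0).
by rewrite mulrA ler_pdivlMr ?ltr0n// mul1r.
Qed.

Section FilterUpperBound.
Context (x betap rho : R) (gam : 'rV[R]_D).
Hypotheses (x_gt0 : 0 < x) (betap_gt0 : 0 < betap) (rho_gt1 : 1 < rho).
Hypothesis gam_ge0 : forall i, 0 <= gam 0 i.
Hypothesis gam_le : forall i,
  gam 0 i <= Num.min (betap * (x `^ s * lam 0 i) `^ rho) 1.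

Lemma sum_filter_le : 1 < s * rho ->
  \sum_i gam 0 i <= (1 + betap) * min_powR_const (s * rho) * x.
Proof.
move=> srho; rewrite -mulrA.
have b1 : 0 < 1 + betap by rewrite addr_gt0.
have := sum_min_spectrum x_gt0 srho; rewrite -(ler_pM2l b1) => /(le_trans _); apply.
rewrite mulr_sumr; apply: ler_sum => i _; apply: le_trans (gam_le i) _.
set z := _ `^ rho; have z0 : 0 <= z by rewrite powR_ge0.
rewrite ge_min; apply/orP; case: (ltP 1 z) => z1; [right|left].
  by rewrite mulr1 lerDl ltW.
by rewrite ler_wpM2r// lerDr.
Qed.

(** With [z = t lam_i] the summand is [t^2 (gam_i / z)^2], and the square is at most
    [(1 + betap^2) min (1, z^(2 rho - 2))], whence the exponent. *)
Lemma sum_filter_amplified_le : 1 < s * (2 * rho - 2) ->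
  \sum_i gam 0 i ^+ 2 * (lam 0 i)^-1 ^+ 2 <=
  (1 + betap ^+ 2) * min_powR_const (s * (2 * rho - 2)) * (x * (x `^ s) ^+ 2).
Proof.
move=> srho; have rho2 : 0 <= 2 * rho - 2 by have := rho_gt1; lra.
set t := x `^ s; have t0 : 0 < t by rewrite powR_gt0.
have b1 : 0 < (1 + betap ^+ 2) * t ^+ 2.
  by rewrite mulr_gt0 ?exprn_gt0// addr_gt0// exprn_gt0.
have := sum_min_spectrum x_gt0 srho; rewrite -(ler_pM2l b1) => h.
apply: le_trans (le_trans h _); last by rewrite le_eqVlt; apply/orP; left; apply/eqP; ring.
rewrite mulr_sumr; apply: ler_sum => i _; rewrite -/t.
have l0 := spectrum_gt0 i; set l := lam 0 i in l0 *.
set z := t * l; have z0 : 0 < z by rewrite mulr_gt0.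
have -> : l^-1 ^+ 2 = t ^+ 2 * z^-1 ^+ 2.
  by rewrite /z invfM exprMn mulrA -exprMn mulfV ?gt_eqF// expr1n mul1r.
rewrite [leRHS]mulrAC mulrCA [leRHS]mulrC ler_pM2l ?exprn_gt0//.
have g0 := gam_ge0 i; have := gam_le i; rewrite le_min -/l -/t -/z => /andP[g1 g2].
have [z1|z1] := leP 1 z.
  rewrite min_l; last first.
    have one q : 1 `^ q = 1 :> R by rewrite powR1.
    rewrite -[leLHS](one (2 * rho - 2)) ge0_ler_powR ?nnegrE ?ler01 ?(ltW z0)//.
  rewrite mulr1 (@le_trans _ _ 1)//; last by rewrite lerDl sqr_ge0.
  rewrite mulr_ile1 ?exprn_ge0 ?invr_ge0 ?(ltW z0)//; first exact: exprn_ile1.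
  by rewrite exprn_ile1 ?invr_ge0 ?(ltW z0)// invf_le1.
have zE : z `^ (2 * rho - 2) = (z `^ rho) ^+ 2 * z^-1 ^+ 2.
  rewrite -!powR_mulrn ?powR_ge0 ?invr_ge0 ?(ltW z0)// -powR_inv1 ?(ltW z0)//.
  rewrite -!powRrM -powRD; last by rewrite (gt_eqF z0) implybT.
  by congr (_ `^ _); ring.
have zle : z `^ (2 * rho - 2) <= 1.
  have one q : 1 `^ q = 1 :> R by rewrite powR1.
  rewrite -[leRHS](one (2 * rho - 2)) ge0_ler_powR ?nnegrE ?ler01 ?(ltW z0) ?(ltW z1)//.
rewrite min_r// zE [leRHS]mulrA ler_wpM2r ?sqr_ge0//.
apply: (@le_trans _ _ ((betap * z `^ rho) ^+ 2)).
  by rewrite lerXn2r ?nnegrE// mulr_ge0 ?powR_ge0 ?ltW.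
by rewrite exprMn ler_wpM2r ?sqr_ge0// lerDr.
Qed.

End FilterUpperBound.

(** * Weak and strong bias over the ellipsoid *)

Section Bias.
Context (radius : R) (mu gam : 'rV[R]_D).
Hypothesis mu_ell : sobolev_ellipsoid d beta radius mu.
Hypothesis gam01 : forall i, 0 <= gam 0 i <= 1.

Definition weak_bias2 mu gam : R :=
  \sum_i (1 - gam 0 i) ^+ 2 * (lam 0 i * mu 0 i) ^+ 2.
Definition strong_bias2 mu gam : R :=
  \sum_i ((1 - gam 0 i) * mu 0 i) ^+ 2.

(** In terms of the spectrum the ellipsoid is a source condition of exponent [theta = beta / p]. *)
Lemma sum_source_le :
  \sum_i lam 0 i `^ (- (2 * theta)) * mu 0 i ^+ 2
    <= cA `^ (- (2 * theta)) * radius ^+ 2.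
Proof.
move: mu_ell; rewrite /sobolev_ellipsoid/= => h.
have := ler_wpM2l (powR_ge0 cA (- (2 * theta))) h; apply: le_trans.
rewrite mulr_sumr; apply: ler_sum => i _; rewrite [leRHS]mulrA ler_wpM2r ?sqr_ge0//.
rewrite mxE powRM ?powR_ge0 ?(ltW cA0)// -powRrM.
suff -> : - (p / d%:R) * - (2 * theta) = 2 * beta / d%:R by [].
by field; rewrite !gt_eqF.
Qed.

(** With [z = t lam_i], [(1 - gam_i)^2] is at most a constant times [z^(-(2 + 2 theta))]: trivially
    for [z <= 1], and for [z > 1] because the squared qualification bound decays like [z^(-4 q)]
    with [4 q >= 2 + 2 theta]. The source condition absorbs the rest. *)
Lemma weak_bias_le t q Cq : 0 < t -> theta <= 2 * q - 1 ->
  (forall i, 1 - gam 0 i <= Cq * (t * lam 0 i) `^ (- (2 * q))) ->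
  weak_bias2 mu gam <= Num.max 1 (Cq ^+ 2) *
    (cA `^ (- (2 * theta)) * radius ^+ 2) * t `^ (- (2 + 2 * theta)).
Proof.
move=> t0 q1 hq; set M := Num.max _ _; have M1 : 1 <= M by rewrite le_max lexx.
have M0 : 0 <= M by exact: le_trans M1.
have h := ler_wpM2l (mulr_ge0 M0 (powR_ge0 t (- (2 + 2 * theta)))) sum_source_le.
apply: le_trans (le_trans h _); last first.
  by rewrite le_eqVlt; apply/orP; left; apply/eqP; ring.
rewrite mulr_sumr; apply: ler_sum => i _.
have l0 := spectrum_gt0 i; have hi := hq i.
set l := lam 0 i in l0 hi *; set z := t * l in hi.
have z0 : 0 < z by rewrite mulr_gt0.
rewrite exprMn [leLHS]mulrA [leRHS]mulrA ler_wpM2r ?sqr_ge0//.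
have /andP[g0 g1] := gam01 i.
have zE : t `^ (- (2 + 2 * theta)) * l `^ (- (2 * theta)) =
    z `^ (- (2 + 2 * theta)) * l ^+ 2.
  rewrite /z powRM ?(ltW t0) ?(ltW l0)// -mulrA -powR_mulrn ?(ltW l0)// -powRD;
    last by rewrite (gt_eqF l0) implybT.
  by congr (_ * _ `^ _); ring.
rewrite -[leRHS]mulrA zE [leRHS]mulrA ler_wpM2r ?sqr_ge0//.
have sq1 : (1 - gam 0 i) ^+ 2 <= 1.
  by rewrite exprn_ile1 ?subr_ge0// lerBlDr lerDl.
have [z1|z1] := leP z 1.
  apply: le_trans sq1 _; rewrite -[leLHS]mulr1; apply: ler_pM => //.
  rewrite powRN invf_ge1 ?powR_gt0// -ler_ln ?posrE ?powR_gt0// ln_powR ln1.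
  by apply: mulr_ge0_le0; [rewrite addr_ge0// mulr_ge0 | exact: ln_le0].
apply: (@le_trans _ _ ((Cq * z `^ (- (2 * q))) ^+ 2)).
  rewrite lerXn2r ?nnegrE ?subr_ge0//.
  by apply: le_trans hi; rewrite subr_ge0.
rewrite exprMn; apply: ler_pM; rewrite ?sqr_ge0//; first by rewrite le_max lexx orbT.
rewrite -powR_mulrn ?powR_ge0// -powRrM ler_powR ?(ltW z1)//; lra.
Qed.

(** Where [t lam_i >= 1] the weak bias is inflated by [(t lam_i)^2]; elsewhere the filter is ignored
    and the source condition is used. The splitting time [t] is unrelated to [gam], so a
    deterministic [t] can be paired with the filter at [tau]. *)
Lemma strong_bias_le t : 0 < t ->
  strong_bias2 mu gam <= t ^+ 2 * weak_bias2 mu gam +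
    t `^ (- (2 * theta)) * (cA `^ (- (2 * theta)) * radius ^+ 2).
Proof.
move=> t0; have := ler_wpM2l (powR_ge0 t (- (2 * theta))) sum_source_le => h.
apply: le_trans (lerD (lexx _) h).
rewrite /strong_bias2 /weak_bias2 !mulr_sumr -big_split/=; apply: ler_sum => i _.
have l0 := spectrum_gt0 i; set l := lam 0 i in l0 *.
have /andP[g0 g1] := gam01 i.
have m0 := sqr_ge0 (mu 0 i); have gm0 := sqr_ge0 ((1 - gam 0 i) * mu 0 i).
have [z1|z1] := leP 1 (t * l).
  apply: ler_wpDr.
    exact: mulr_ge0 (powR_ge0 _ _) (mulr_ge0 (powR_ge0 _ _) m0).
  have -> : t ^+ 2 * ((1 - gam 0 i) ^+ 2 * (l * mu 0 i) ^+ 2) =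
    (t * l) ^+ 2 * ((1 - gam 0 i) * mu 0 i) ^+ 2 by ring.
  by rewrite ler_peMl// exprn_ege1.
apply: ler_wpDl.
  exact: mulr_ge0 (sqr_ge0 _) (mulr_ge0 (sqr_ge0 _) (sqr_ge0 _)).
rewrite [leRHS]mulrA -powRM ?(ltW t0) ?(ltW l0)// exprMn ler_wpM2r//.
apply: (@le_trans _ _ 1).
  by rewrite exprn_ile1 ?subr_ge0// lerBlDr lerDl.
have z0 : 0 < t * l by rewrite mulr_gt0.
rewrite powRN invf_ge1 ?powR_gt0// -ler_ln ?posrE ?powR_gt0// ln_powR ln1.
by apply: mulr_ge0_le0; [rewrite mulr_ge0 | exact/ln_le0/ltW].
Qed.

End Bias.

End Spectrum.

(** * Filters and hitting times *)

Section HittingTimes.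
Context {R : realType}.
Implicit Types (F : R -> R) (a b v l t u : R).

Lemma cvg_sum_seq (T I : Type) (F : set_system T) {FF : Filter F} (r : seq I)
    (f : I -> T -> R) (l : I -> R) :
  (forall i, f i x @[x --> F] --> l i) ->
  \sum_(i <- r) f i x @[x --> F] --> \sum_(i <- r) l i.
Proof.
move=> fl; elim: r => [|i r IH].
  by under eq_fun do rewrite big_nil; rewrite big_nil; exact: cvg_cst.
under eq_fun do rewrite big_cons; rewrite big_cons.
by apply: (@cvgD _ R^o).
Qed.

Lemma continuous_sqr_one_sub : continuous (fun x : R => (1 - x) ^+ 2).
Proof.
have c1 : continuous (fun x : R => 1 - x).
  by move=> x; apply: (@cvgB _ R^o); [exact: cvg_cst | exact: cvg_id].
have -> : (fun x => (1 - x) ^+ 2) = (fun x => (1 - x) * (1 - x)) :> (R -> R) by [].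
by move=> x; apply: cvgM; exact: c1.
Qed.

Lemma ivt_unbounded F a v l : 0 <= a ->
  {within `[0, +oo[, continuous F} -> F t @[t --> +oo] --> l ->
  F a <= v < l -> exists2 u, a <= u & F u = v.
Proof.
move=> a0 cF Fl /andP[Fav vl].
have [b ab vb] : exists2 b, a <= b & v <= F b.
  have : \forall t \near +oo, v < F t by exact: cvgr_gt Fl _ vl.
  move=> /(filterI (nbhs_pinfty_ge (num_real a))) /filter_ex [b [ab /ltW vb]].
  by exists b.
have cF' : {within `[a, b], continuous F}.
  apply: continuous_subspaceW cF => t /=; rewrite !in_itv/= andbT => /andP[+ _].
  exact: le_trans.
have [|u] := @IVT R F a b v ab cF'.
  by rewrite ge_min Fav le_max vb orbT.
by rewrite in_itv/= => /andP[au _]; exists u.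
Qed.

Section Filter.
Context (g : R -> R -> R) (t0 rho betam betap : R) (D : nat) (lam : 'rV[R]_D).
Hypothesis gR : assumption_R t0 rho betam betap g.
Hypothesis lam_gt0 : forall i, 0 < lam 0 i.

Local Notation gam := (regulariser_filter g lam).

Lemma filter_bounds t i : 0 <= t -> 0 <= gam t 0 i <= 1.
Proof. by move=> t_ge0; rewrite mxE; apply: (regR_range gR) => //; exact: ltW. Qed.

Lemma filter_nondecreasing t t' i : 0 <= t' -> t' <= t ->
  gam t' 0 i <= gam t 0 i.
Proof. by move=> t'0 tt; rewrite !mxE; apply: (regR1_time gR) => //; exact: ltW. Qed.

Lemma filter_sum_continuous (c : 'I_D -> R) (h : R -> R) : continuous h ->
  {within `[0, +oo[, continuous (fun t => \sum_i c i * h (gam t 0 i))}.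
Proof.
move=> ch t; apply: cvg_sum_seq => i; apply: cvgM; first exact: cvg_cst.
have cg : {within `[0, +oo[, continuous (fun t => gam t 0 i)}.
  rewrite (_ : (fun t => _) = (fun t => g t (lam 0 i))).
    have cg := regR1_cont gR (lam_gt0 i); exact: cg.
  by apply/funext => x; rewrite mxE.
exact: cvg_comp (cg t) (ch _).
Qed.

Lemma filter_sum_cvg (c : 'I_D -> R) (h : R -> R) : continuous h ->
  \sum_i c i * h (gam t 0 i) @[t --> +oo] --> \sum_i c i * h 1.
Proof.
move=> ch; apply: cvg_sum_seq => i; apply: cvgM; first exact: cvg_cst.
have gl := regR1_lim gR (lam_gt0 i).
rewrite (_ : (fun t => h (gam t 0 i)) = (fun t => h (g t (lam 0 i)))); last first.
  by apply/funext => x; rewrite mxE.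
exact: cvg_comp gl (ch 1).
Qed.

(** As [h 1 = 0] the sum vanishes at infinity, so it crosses every positive level below its value at
    [a]. With [h x = (1 - x)^2] this yields the time at which the weak bias equals a level. *)
Lemma filter_sum_hits (c : 'I_D -> R) (h : R -> R) a v : continuous h ->
  h 1 = 0 -> 0 <= a -> 0 < v <= \sum_i c i * h (gam a 0 i) ->
  exists2 u, a <= u & \sum_i c i * h (gam u 0 i) = v.
Proof.
move=> ch h1 a0 /andP[v0 vF].
have chN : continuous (fun x => - h x) by move=> x; apply: (@cvgN _ R^o); exact: ch.
have [|u au uE] := ivt_unbounded (v := - v) a0
    (filter_sum_continuous (c := c) chN) (filter_sum_cvg (c := c) chN).
  rewrite h1 [X in _ < X]big1; last by move=> i _; rewrite oppr0 mulr0.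
  rewrite oppr_lt0 v0 andbT.
  by under eq_bigr do rewrite mulrN; rewrite sumrN lerN2.
exists u => //; apply: oppr_inj; rewrite -uE -sumrN.
by apply: eq_bigr => i _; rewrite mulrN.
Qed.

(** The infimum is attained: were the sum below the level at [ti], it would reach an intermediate
    value at some [m] above [ti], and all points of the level set would lie beyond [m]. *)
Lemma initial_time_spec (delta C0 : R) : 0 < delta -> 0 < C0 ->
  C0 < Num.sqrt D%:R -> let ti := initial_time delta gam C0 in
  0 < ti /\ \sum_i gam ti 0 i ^+ 2 = C0 * Num.sqrt D%:R.
Proof.
move=> del0 C00 C0D ti; pose F t := \sum_i gam t 0 i ^+ 2.
set c := C0 * _; set S := [set t | 0 <= t /\ weak_variance delta gam t = c * delta ^+ 2].
have SE : S = [set t | 0 <= t /\ F t = c].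
  apply/seteqP; split=> t [h1 h2]; split=> //; move: h2; rewrite /weak_variance -/(F t).
    by rewrite mulrC => /mulIf; apply; rewrite expf_neq0// gt_eqF.
  by move=> ->; rewrite mulrC.
have tiE : ti = inf S by [].
have c0 : 0 < c by rewrite mulr_gt0// (lt_trans C00).
(* The level lies below the limit [D] of the sum, so the infimum is over a nonempty set and not a
   default value. *)
have cD : c < D%:R.
  by rewrite -[ltRHS]sqr_sqrtr// expr2 ltr_pM2r// (lt_trans C00).
have FE t : \sum_i 1 * gam t 0 i ^+ 2 = F t by apply: eq_bigr => i _; rewrite mul1r.
have csq : continuous (fun x : R => x ^+ 2) by exact: sqr_continuous.
have cF : {within `[0, +oo[, continuous F}.
  have := filter_sum_continuous (c := fun=> 1) csq.
  by rewrite (_ : (fun t => _) = F)//; apply/funext => t; rewrite FE.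
have Fl : F t @[t --> +oo] --> (D%:R : R).
  have := filter_sum_cvg (c := fun=> 1) csq.
  rewrite (_ : (fun t => _) = F); last by apply/funext => t; rewrite FE.
  by under eq_bigr do rewrite expr1n mulr1; rewrite sumr_const card_ord.
have F0 : F 0 = 0.
  by rewrite /F big1// => i _; rewrite mxE (regR1_init gR)// expr0n.
have Fmono t t' : 0 <= t' -> t' <= t -> F t' <= F t.
  move=> t'0 tt; apply: ler_sum => i _; have := filter_nondecreasing i t'0 tt.
  have /andP[h0 _] := filter_bounds i t'0.
  by move=> h; rewrite lerXn2r ?nnegrE// (le_trans h0).
have [|s1 s10 Fs1] := ivt_unbounded (lexx 0) cF Fl (v := c).
  by rewrite F0 (ltW c0) cD.
have S0 : S s1 by rewrite SE; split.
have lbS : lbound S 0 by move=> t; rewrite SE => -[].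
have hS : has_inf S by split; [exists s1 | exists 0].
have ti0 : 0 <= ti by rewrite tiE; apply: lb_le_inf => //; exists s1.
have tis : ti <= s1 by rewrite tiE; apply: ge_inf => //; case: hS.
have Fti : F ti = c.
  have Ftic : F ti <= c by rewrite -Fs1; exact: Fmono.
  apply/eqP; rewrite eq_le Ftic /= leNgt; apply/negP => Fc.
  pose v := (F ti + c) / 2.
  have v1 : F ti < v by rewrite /v; lra.
  have v2 : v < c by rewrite /v; lra.
  have [|m tim Fm] := ivt_unbounded ti0 cF Fl (v := v).
    by rewrite (ltW v1) (lt_trans v2 cD).
  have : m <= ti.
    rewrite tiE; apply: lb_le_inf; first by exists s1.
    move=> s; rewrite SE => -[s0 Fs]; rewrite leNgt; apply/negP => sm.
    have := Fmono _ _ s0 (ltW sm); rewrite Fs Fm; lra.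
  move=> mti; have mE : m = ti by apply/eqP; rewrite eq_le mti tim.
  by move: v1; rewrite -Fm mE ltxx.
split=> //; rewrite lt_neqAle ti0 andbT; apply/eqP => tE.
by move: Fti c0; rewrite -tE F0 => <-; rewrite ltxx.
Qed.

Section Stopping.
Context (delta C0 kappa : R) (Y : 'rV[R]_D).
Hypotheses (kappa_gt0 : 0 < kappa).
Local Notation ti := (initial_time delta gam C0).
Local Notation tau := (stopping_time delta gam C0 kappa Y).
Hypothesis ti_ge0 : 0 <= ti.

Let stop_set := [set t | ti <= t /\ residual2 gam t Y <= kappa].

(** The residual tends to 0 and the threshold is positive; this keeps the infimum defining [tau]
    from being that of the empty set. *)
Let stop_set_neq0 : stop_set !=set0.
Proof.
have := filter_sum_cvg (c := fun i => Y 0 i ^+ 2) continuous_sqr_one_sub.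
rewrite big1; last by move=> i _; rewrite subrr expr0n mulr0.
move=> cv; have : \forall t \near +oo, \sum_i Y 0 i ^+ 2 * (1 - gam t 0 i) ^+ 2 < kappa.
  exact: cvgr_lt cv _ kappa_gt0.
move=> /(filterI (nbhs_pinfty_ge (num_real ti))) /filter_ex [b [tib bk]].
exists b; split=> //; apply/ltW; rewrite /residual2.
by under eq_bigr do rewrite mulrC.
Qed.

Lemma initial_le_stopping_time : ti <= tau.
Proof. by apply: lb_le_inf => // t []. Qed.

Lemma stopping_time_le t : ti <= t -> residual2 gam t Y <= kappa -> tau <= t.
Proof. by move=> tt rk; apply: ge_inf => //; exists ti => s []. Qed.

Lemma stopping_time_ge t : ti <= t -> kappa < residual2 gam t Y -> t <= tau.
Proof.
move=> tt rk; apply: lb_le_inf => // s [ts rs].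
rewrite leNgt; apply/negP => st; move: rk; rewrite ltNge => /negP; apply.
apply: le_trans rs; apply: ler_sum => i _; rewrite ler_wpM2r ?sqr_ge0//.
have s0 := le_trans ti_ge0 ts; have tg := le_trans s0 (ltW st).
have /andP[_ h1] := filter_bounds i tg; have h := filter_nondecreasing i s0 (ltW st).
have /andP[_ h2] := filter_bounds i s0.
by rewrite lerXn2r ?nnegrE ?subr_ge0// lerB.
Qed.

End Stopping.
End Filter.
End HittingTimes.

(** * Deviations of the residual *)

Section Deviation.
Context {R : realType}.

(** At the first level not exceeded, [x] is at most [V 0] or the [W] of the previous level. In use
    [W j] is a nonnegative majorant of [V j.+1] times the indicator that level [j] is exceeded. *)
Lemma le_dyadic (V W : nat -> R) (x : R) J : 0 <= V 0%N ->
  (forall j, 0 <= W j) -> (forall j, V j < x -> V j.+1 <= W j) ->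
  x <= V J -> x <= V 0%N + \sum_(j < J) W j.
Proof.
move=> V0 W0 VW; elim: J => [|J IH] xJ; first by rewrite big_ord0 addr0.
rewrite big_ord_recr/= addrA; have [/IH xV|Vx] := leP x (V J).
  by rewrite (le_trans xV)// lerDl.
apply: le_trans xJ _; apply: le_trans (VW _ Vx) _.
by rewrite lerDr addr_ge0// sumr_ge0.
Qed.

Lemma sum_half_powers J : \sum_(j < J) (2^-1 : R) ^+ j <= 2.
Proof.
suff : \sum_(j < J) (2^-1 : R) ^+ j <= 2 - 2 * 2^-1 ^+ J.
  have : 0 <= (2^-1 : R) ^+ J by rewrite exprn_ge0.
  lra.
elim: J => [|J IH]; first by rewrite big_ord0 expr0 mulr1 subrr.
by rewrite big_ord_recr/= exprS; move: IH; lra.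
Qed.

(** Polynomial decay of sufficient order turns the dyadic sums into geometric series. *)
Lemma expRN_le_fact (z : R) n : 0 < z -> expR (- z) <= n.+1`!%:R / z ^+ n.+1.
Proof.
move=> z0; rewrite expRN -[leRHS]invrK invf_div lef_pV2 ?posrE ?expR_gt0//.
  by apply: le_trans (expR_ge1Dxn n (ltW z0)); rewrite lerDr.
by rewrite divr_gt0 ?exprn_gt0// ltr0n fact_gt0.
Qed.

Section Residual.
Context {disp : measure_display} {T : measurableType disp}.
Context {P : probability T R} {D : nat} (eps : 'I_D -> {RV P >-> R}).
Hypothesis indep : mutually_independent eps.
Hypothesis normal : forall i, standard_normal (eps i).
Context (cA p : R) (d : nat) (delta kappa : R) (mu : 'rV[R]_D).
Hypotheses (delta_gt0 : 0 < delta) (D_gt0 : (0 < D)%N).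
Local Notation lam := (power_spectrum cA p d D).

(** The second order term is [4 S^2 (delta^4 D + delta^4 F)] at most, and [S^2 = 1 / (64 delta^4 D)]
    turns it into [1/16 + F / (16 D)]. The sign [sg] selects the direction of the deviation. *)
Lemma mean_exp_residual (gam : R -> 'rV[R]_D) (t sg : R) :
  (forall i, 0 <= gam t 0 i <= 1) -> `|sg| = 1 ->
  let F := weak_bias2 cA p d mu (gam t) / delta ^+ 2 in
  mean_le P (fun w => expR (sg / (8 * delta ^+ 2 * Num.sqrt D%:R) *
      (residual2 gam t (observation lam delta mu (\row_i eps i w)) - kappa)))
    (expR (sg / (8 * Num.sqrt D%:R) *
       (F + \sum_i (1 - gam t 0 i) ^+ 2 - kappa / delta ^+ 2)
     + 16^-1 + F / (16 * D%:R))).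
Proof.
move=> gam01 sg1 F.
have dl0 : 0 < delta ^+ 2 by rewrite exprn_gt0.
have D0 : 0 < D%:R :> R by rewrite ltr0n.
have D1 : 1 <= D%:R :> R by rewrite ler1n.
have sD0 : 0 < Num.sqrt D%:R :> R by rewrite sqrtr_gt0.
have sD2 : Num.sqrt D%:R ^+ 2 = D%:R :> R by rewrite sqr_sqrtr// ltW.
have sD1 : 1 <= Num.sqrt D%:R :> R by rewrite -[leLHS]sqrtr1 ler_wsqrtr.
set S := sg / (8 * delta ^+ 2 * Num.sqrt D%:R).
have dn0 := gt_eqF dl0; have sDn0 := gt_eqF sD0.
pose a i := (1 - gam t 0 i) * delta.
pose b i := (1 - gam t 0 i) * (lam 0 i * mu 0 i).
have h1 i : (1 - gam t 0 i) ^+ 2 <= 1.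
  have /andP[g0 g1] := gam01 i.
  by rewrite exprn_ile1 ?subr_ge0// lerBlDr lerDl.
have Sabs : `|S| = (8 * delta ^+ 2 * Num.sqrt D%:R)^-1.
  by rewrite normrM sg1 mul1r gtr0_norm// invr_gt0 !mulr_gt0.
have sa i : `|S| * a i ^+ 2 <= 4^-1.
  rewrite Sabs mulrC ler_pdivrMr ?mulr_gt0// /a exprMn.
  apply: (@le_trans _ _ (1 * delta ^+ 2)); first by rewrite ler_wpM2r// ltW.
  nra.
have := mean_exp_sum_sqr indep normal b (- (S * kappa)) sa.
apply: mean_le_weaken.
  move=> w; rewrite ler_expR mulrBr lerD2r /residual2.
  rewrite le_eqVlt; apply/orP; left; apply/eqP; congr (_ * _).
  by apply: eq_bigr => i _; rewrite -exprMn /a /b !mxE; congr (_ ^+ 2); ring.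
rewrite ler_expR.
pose f := weak_bias2 cA p d mu (gam t); pose V := \sum_i (1 - gam t 0 i) ^+ 2.
have f0 : 0 <= f by apply: sumr_ge0 => i _; rewrite mulr_ge0 ?sqr_ge0.
have E1 : \sum_i (a i ^+ 2 + b i ^+ 2) = delta ^+ 2 * V + f.
  rewrite big_split/= /V mulr_sumr; congr (_ + _); apply: eq_bigr => i _.
    by rewrite /a exprMn mulrC.
  by rewrite /b exprMn.
have E2 : \sum_i (a i ^+ 4 + a i ^+ 2 * b i ^+ 2) <=
    delta ^+ 4 * D%:R + delta ^+ 2 * f.
  rewrite big_split/= mulr_sumr; apply: lerD.
    rewrite -[D in D%:R]card_ord -sumr_const mulr_sumr; apply: ler_sum => i _.
    rewrite mulr1 /a exprMn ler_piMl ?exprn_ge0 ?(ltW delta_gt0)//.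
    by rewrite (exprM _ 2 2) exprn_ile1 ?sqr_ge0.
  apply: ler_sum => i _; set z := (1 - gam t 0 i) ^+ 2 * (lam 0 i * mu 0 i) ^+ 2.
  have -> : a i ^+ 2 * b i ^+ 2 = delta ^+ 2 * z * (1 - gam t 0 i) ^+ 2.
    by rewrite /a /b /z; ring.
  apply: ler_piMr => //.
  exact: mulr_ge0 (ltW dl0) (mulr_ge0 (sqr_ge0 _) (sqr_ge0 _)).
have S2 : S ^+ 2 = (64 * delta ^+ 4 * D%:R)^-1.
  have sg2 : sg ^+ 2 = 1 by rewrite -real_normK ?num_real// sg1 expr1n.
  rewrite /S exprMn sg2 mul1r exprVn; congr (_^-1).
  by rewrite !exprMn sD2; ring.
rewrite E1.
apply: (@le_trans _ _ (S * (delta ^+ 2 * V + f) +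
   4 * S ^+ 2 * (delta ^+ 4 * D%:R + delta ^+ 2 * f) + - (S * kappa))).
  by rewrite lerD2r lerD2l ler_wpM2l// mulr_ge0 ?sqr_ge0.
rewrite S2 le_eqVlt; apply/orP; left; apply/eqP; rewrite /S /F -/f -/V.
by field; rewrite ?gt_eqF.
Qed.

End Residual.
End Deviation.

(** * The risk at a fixed noise level *)

Lemma exists_le_pow2 (R : realType) (x k : R) : 0 < k -> exists J, x <= k * 2 ^+ J.
Proof.
move=> k0; exists (Num.truncn (x / k)).+1.
rewrite mulrC -ler_pdivrMr//; apply/ltW; apply: lt_le_trans (truncnS_gt _) _.
by rewrite -natrX ler_nat ltnW// ltn_expl.
Qed.

Lemma powR_exprn (R : realType) (x r : R) n : 0 <= x ->
  (x ^+ n) `^ r = (x `^ r) ^+ n.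
Proof. by move=> x0; rewrite -powR_mulrn// powRAC powR_mulrn ?powR_ge0. Qed.

Section NoiseLevel.
Context {R : realType} (radius beta p : R) (d : nat).
Context (rho betam betap Ckappa C0 cA Cq q c : R) (g : R -> R -> R).
Hypotheses (radius_gt0 : 0 < radius) (beta_ge0 : 0 <= beta) (p_gt0 : 0 < p).
Hypotheses (d_gt0 : (0 < d)%N) (rho_gt1 : 1 < rho) (betam_gt0 : 0 < betam).
Hypotheses (betap_gt0 : 0 < betap) (C0_gt0 : 0 < C0) (Ckappa_ge0 : 0 <= Ckappa).
Hypotheses (cA_bnd : 0 < cA <= 1) (q_large : beta / p <= 2 * q - 1) (c_gt0 : 0 < c).

Local Notation s := (p / d%:R).
Local Notation theta := (beta / p).

Hypotheses (srho : 1 < s * rho) (srho2 : 1 < s * (2 * rho - 2)).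

Context (delta kappa : R) (D : nat) {disp : measure_display}.
Context {T : measurableType disp} {P : probability T R}.
Context (eps : 'I_D -> {RV P >-> R}) (mu : 'rV[R]_D).

Local Notation lam := (power_spectrum cA p d D).
Local Notation gam := (regulariser_filter g lam).
Local Notation ti := (initial_time delta gam C0).
Local Notation xs := ((radius / delta) `^ (2 * d%:R / (2 * beta + 2 * p + d%:R))).
Local Notation ts := (xs `^ s).
Local Notation Y w := (observation lam delta mu (\row_i eps i w)).
Local Notation tau w := (stopping_time delta gam C0 kappa (Y w)).
Local Notation f t := (weak_bias2 cA p d mu (gam t)).
Local Notation sD := (Num.sqrt (D%:R : R)).

Hypotheses (delta_gt0 : 0 < delta) (C0D : C0 < sD).
Hypothesis indep : mutually_independent eps.
Hypothesis normal : forall i, standard_normal (eps i).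
Hypothesis gR : assumption_R ti rho betam betap g.
Hypothesis kappa_gt0 : 0 < kappa.
Hypothesis kappaD : `|kappa - D%:R * delta ^+ 2| <= Ckappa * sD * delta ^+ 2.
Hypothesis qualif : forall t l : R, ti <= t -> 0 < l <= 1 ->
  1 - g t l <= Cq * (t * l) `^ (- (2 * q)).
Hypothesis xs_ge : c * sD <= xs.
Hypothesis mu_ell : sobolev_ellipsoid d beta radius mu.

Let d0 : 0 < d%:R :> R. Proof. by rewrite ltr0n. Qed.
Let s0 : 0 < s. Proof. by rewrite divr_gt0. Qed.
Let theta0 : 0 <= theta. Proof. by rewrite divr_ge0// ltW. Qed.
Let xs0 : 0 < xs. Proof. by rewrite powR_gt0// divr_gt0. Qed.
Let ts0 : 0 < ts. Proof. by rewrite powR_gt0. Qed.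
Let del20 : 0 < delta ^+ 2. Proof. by rewrite exprn_gt0. Qed.
Let sD0 : 0 < sD. Proof. exact: lt_trans C0_gt0 C0D. Qed.
Let D0 : 0 < D%:R :> R. Proof. by move: sD0; rewrite sqrtr_gt0. Qed.
Let D_gt0 : (0 < D)%N. Proof. by move: D0; rewrite ltr0n. Qed.
Let sD2 : sD ^+ 2 = D%:R. Proof. by rewrite sqr_sqrtr// ltW. Qed.
Let sD1 : 1 <= sD.
Proof. by rewrite -[leLHS]sqrtr1 ler_wsqrtr// ler1n. Qed.
Let lam0 i : 0 < lam 0 i. Proof. exact: spectrum_gt0. Qed.
Let tiP : 0 < ti /\ \sum_i gam ti 0 i ^+ 2 = C0 * sD.
Proof. exact: (initial_time_spec gR lam0 delta_gt0 C0_gt0 C0D). Qed.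
Let ti_gt0 : 0 < ti. Proof. by case: tiP. Qed.

(** This balance between weak bias and noise at effective dimension [xs] is what determines the
    exponent of [xs]. *)
Lemma radius_critical_time : radius ^+ 2 * ts `^ (- (2 + 2 * theta)) = delta ^+ 2 * xs.
Proof.
set L := radius / delta; have L0 : 0 < L by rewrite divr_gt0.
have -> : radius = delta * L by rewrite /L mulrC divfK// gt_eqF.
rewrite exprMn -[LHS]mulrA; congr (_ * _).
rewrite -powR_mulrn ?(ltW L0)// -!powRrM -powRD; last by rewrite (gt_eqF L0) implybT.
congr (_ `^ _).
have m0 : 2 * beta + 2 * p + d%:R != 0.
  by apply: lt0r_neq0; move: beta_ge0 p_gt0 d0; lra.
by field; rewrite m0 !gt_eqF.
Qed.

(** The tolerance of order [sqrt D] in the threshold is absorbed into a multiple of [xs]. *)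
Lemma kappa_bounds : D%:R - Ckappa / c * xs <= kappa / delta ^+ 2
  /\ kappa / delta ^+ 2 <= D%:R + Ckappa / c * xs.
Proof.
have cs : Ckappa * sD <= Ckappa / c * xs.
  rewrite -mulrA ler_wpM2l// mulrC ler_pdivlMr// mulrC.
  exact: xs_ge.
have h : `|kappa / delta ^+ 2 - D%:R| <= Ckappa * sD.
  have -> : kappa / delta ^+ 2 - D%:R = (kappa - D%:R * delta ^+ 2) / delta ^+ 2.
    by rewrite mulrBl mulfK// gt_eqF.
  by rewrite normrM [`|_^-1|]gtr0_norm ?invr_gt0// ler_pdivrMr.
by move: h; rewrite ler_norml => /andP[h1 h2]; split; lra.
Qed.

Let gam01 t i : 0 <= t -> 0 <= gam t 0 i <= 1.
Proof. by move=> t0; exact: (filter_bounds gR lam0). Qed.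

Let sum_gam_le x : 0 < x -> ti <= x `^ s ->
  \sum_i gam (x `^ s) 0 i <= (1 + betap) * min_powR_const (s * rho) * x.
Proof.
move=> x0 tx; apply: (sum_filter_le cA_bnd p_gt0 d_gt0 x0 betap_gt0 _ srho) => i.
have /andP[_] : betam * Num.min ((x `^ s * lam 0 i) `^ rho) 1 <= gam (x `^ s) 0 i
    <= Num.min (betap * (x `^ s * lam 0 i) `^ rho) 1.
  rewrite [gam _ 0 i]mxE; apply: (regR3 gR) => //.
  by rewrite lam0 spectrum_le1.
by [].
Qed.

Definition weak_bias_const : R := Num.max 1 (Cq ^+ 2) * cA `^ (- (2 * theta)).

Let f_le t : ti <= t -> f t <= weak_bias_const * (radius ^+ 2 * t `^ (- (2 + 2 * theta))).
Proof.
move=> tt; have t0 : 0 < t by exact: lt_le_trans tt.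
have := @weak_bias_le _ cA p beta d D cA_bnd p_gt0 d_gt0 beta_ge0 radius mu
  (gam t) mu_ell (fun i => gam01 i (ltW t0)) t q Cq t0 q_large.
move=> h; apply: le_trans (h _) _.
  by move=> i; rewrite [gam _ 0 i]mxE; apply: qualif => //; rewrite lam0 spectrum_le1.
by rewrite /weak_bias_const !mulrA.
Qed.

Let f_mono t t' : 0 <= t' -> t' <= t -> f t <= f t'.
Proof.
move=> t'0 tt; apply: ler_sum => i _; rewrite ler_wpM2r ?sqr_ge0//.
have t0 := le_trans t'0 tt.
have /andP[_ h1] := gam01 i t'0; have /andP[_ h2] := gam01 i t0.
by rewrite lerXn2r ?nnegrE ?subr_ge0// lerB// (filter_nondecreasing gR lam0).
Qed.

Let tau_ge w : ti <= tau w.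
Proof. exact: (initial_le_stopping_time gR lam0 _ _ _ kappa_gt0). Qed.

Definition filter_sum_const : R := (1 + betap) * min_powR_const (s * rho).

(** [G] majorises the indicator of the event. If the level is not reached even at [ti] the event is
    empty; otherwise it forces the residual at the hitting time [u] to be at most [kappa], although
    its mean there is larger by order [delta^2 xs y]. *)
Lemma weak_bias_tail y : weak_bias_const <= y -> 4 * (2 * filter_sum_const + Ckappa / c) <= y -> 0 < y ->
  exists G : T -> R, [/\ forall w, 0 <= G w,
    forall w, delta ^+ 2 * xs * y < f (tau w) -> 1 <= G w &
    mean_le P G (expR (16^-1 - c * y / 32))].
Proof.
move=> Cby Ky y0; set z := delta ^+ 2 * xs * y.
have z0 : 0 < z by rewrite !mulr_gt0.
have [fz|fz] := leP (f ti) z.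
  exists (cst 0); split=> //.
    move=> w; rewrite ltNge (le_trans _ fz)//; apply: f_mono => //.
    exact: ltW.
  by apply: mean_le_weaken (mean_le_cst (lexx 0)) => //; exact: expR_ge0.
have [u tu fu] : exists2 u, ti <= u & f u = z.
  have [||u tu fuE] := filter_sum_hits gR lam0 (c := fun i => (lam 0 i * mu 0 i) ^+ 2)
      (@continuous_sqr_one_sub R) _ (ltW ti_gt0) (v := z).
  - by rewrite subrr expr0n.
  - rewrite z0/=; apply: le_trans (ltW fz) _; rewrite le_eqVlt; apply/orP; left.
    by apply/eqP; apply: eq_bigr => i _; rewrite mulrC.
  - by exists u => //; rewrite -fuE; apply: eq_bigr => i _; rewrite mulrC.
have u0 : 0 < u by exact: lt_le_trans tu.
(* The weak bias at [u] is [y] times its critical order at [ts], and [y] dominates the constant of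
   the weak bias bound. Hence the filter mass at [u] is of order [xs]. *)
have uts : u <= ts.
  have := f_le tu; rewrite fu /z -radius_critical_time => h.
  rewrite leNgt; apply/negP => tsu.
  have e0 : 0 < 2 + 2 * theta by rewrite ltr_wpDr// mulr_ge0.
  suff : ts `^ (- (2 + 2 * theta)) <= u `^ (- (2 + 2 * theta)).
    apply/negP; rewrite -ltNge.
    rewrite [ltLHS]powRN [ltRHS]powRN ltf_pV2 ?posrE ?powR_gt0 ?divr_gt0//.
    by apply: gt0_ltr_powR; rewrite ?nnegrE ?(ltW u0) ?(ltW ts0).
  have r20 : 0 < radius ^+ 2 by rewrite exprn_gt0.
  rewrite -(ler_pM2l r20) -(ler_pM2r y0).
  apply: le_trans h _; rewrite mulrC ler_wpM2l//.
  by rewrite mulr_ge0 ?powR_ge0 ?(ltW r20).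
have tits : ti <= ts by exact: le_trans uts.
have sumg : \sum_i gam u 0 i <= filter_sum_const * xs.
  apply: le_trans (sum_gam_le xs0 tits); apply: ler_sum => i _.
  by apply: (filter_nondecreasing gR lam0) => //; exact: ltW.
pose G w := expR (-1 / (8 * delta ^+ 2 * sD) * (residual2 gam u (Y w) - kappa)).
have := @mean_exp_residual R _ _ P D eps indep normal cA p d delta kappa mu
  delta_gt0 D_gt0 gam u (-1) (fun i => gam01 i (ltW u0)) (normrN1 R).
rewrite fu => GE; exists G; split.
- by move=> w; exact: expR_ge0.
- move=> w fw; rewrite /G -[leLHS]expR0 ler_expR mulN1r mulNr oppr_ge0.
  rewrite pmulr_rle0; last by rewrite invr_gt0 !mulr_gt0.
  rewrite subr_le0 leNgt; apply/negP => kr.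
  have ut : u <= tau w by exact: (stopping_time_ge gR lam0 kappa_gt0 (ltW ti_gt0)).
  by move: fw; rewrite ltNge -fu f_mono// ltW.
- apply: mean_le_weaken GE => //; rewrite ler_expR.
  have -> : z / delta ^+ 2 = xs * y.
    by rewrite /z -[delta ^+ 2 * xs * y]mulrA mulrC mulKf ?gt_eqF.
  have VE : D%:R - 2 * (filter_sum_const * xs) <= \sum_i (1 - gam u 0 i) ^+ 2.
    have : \sum_i (1 - 2 * gam u 0 i) <= \sum_i (1 - gam u 0 i) ^+ 2.
      apply: ler_sum => i _; have := sqr_ge0 (gam u 0 i); lra.
    apply: le_trans; rewrite sumrB sumr_const card_ord lerB// -mulr_sumr.
    by rewrite ler_pM2l.
  set V := \sum_i (1 - gam u 0 i) ^+ 2 in VE *.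
  have [_ kD] := kappa_bounds.
  have sV : 0 < sD^-1 by rewrite invr_gt0.
  have xsD : c <= xs * sD^-1 by rewrite ler_pdivlMr.
  have hK : (2 * filter_sum_const + Ckappa / c) * xs <= y / 4 * xs by rewrite ler_pM2r//; lra.
  (* Divided by 8 this gain is [3/32]; the second order term takes back at most [2/32], leaving the
     [1/32] of the tail. *)
  have e1 : xs * y * (3 / 4) <= xs * y + V - kappa / delta ^+ 2 by lra.
  have sV1 : sD^-1 <= 1 by rewrite invf_le1.
  have xy0 : 0 < xs * y by rewrite mulr_gt0.
  have e2 : sD^-1 * (xs * y * (3 / 4)) <= sD^-1 * (xs * y + V - kappa / delta ^+ 2).
    by rewrite ler_pM2l.
  have e3 : c * y <= xs * sD^-1 * y by rewrite ler_pM2r.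
  have e4 : xs * y * sD^-1 * sD^-1 <= xs * y * sD^-1.
    by rewrite ler_piMr// mulr_ge0 ?(ltW xy0) ?(ltW sV).
  have -> : -1 / (8 * sD) = - (sD^-1 / 8) by rewrite invfM mulN1r mulrC.
  have -> : xs * y / (16 * D%:R) = xs * y * sD^-1 * sD^-1 / 16.
    have Di : D%:R^-1 = sD^-1 * sD^-1 by rewrite -invfM -expr2 sD2.
    by rewrite invfM Di; ring.
  lra.
Qed.

Lemma mean_weak_bias K : weak_bias_const <= K -> 4 * (2 * filter_sum_const + Ckappa / c) <= K -> 0 < K ->
  mean_le P (fun w => f (tau w))
    (K * (1 + 8 * expR 16^-1 * (32 / (c * K)) ^+ 2) * (delta ^+ 2 * xs)).
Proof.
move=> CbK K1K K0; set E := delta ^+ 2 * xs.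
have E0 : 0 < E by rewrite mulr_gt0.
have pow1 j : 1 <= 2 ^+ j :> R by rewrite exprn_ege1// ler1n.
have tail j : exists G : T -> R, [/\ forall w, 0 <= G w,
    forall w, E * (K * 2 ^+ j) < f (tau w) -> 1 <= G w &
    mean_le P G (expR (16^-1 - c * (K * 2 ^+ j) / 32))].
  have KK : K <= K * 2 ^+ j by rewrite ler_peMr// ltW.
  by apply: weak_bias_tail; [exact: le_trans KK..|exact: lt_le_trans KK].
have [G GP] := choice tail.
have EK0 : 0 < E * K by rewrite mulr_gt0.
(* [f (tau w) <= f ti] makes finitely many levels enough; the final bound is free of [J]. *)
have [J fJ] := exists_le_pow2 (f ti) EK0.
pose V j := E * (K * 2 ^+ j).
have V0 j : 0 <= V j by rewrite !mulr_ge0 ?exprn_ge0 ?ltW.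
have pathwise w : f (tau w) <= V 0%N + \sum_(j < J) V j.+1 * G j w.
  apply: (le_dyadic (V := V) (W := fun j => V j.+1 * G j w)) => //.
  - by move=> j; have [G0 _ _] := GP j; rewrite mulr_ge0.
  - by move=> j Vf; have [_ G1 _] := GP j; rewrite ler_peMr// G1.
  - rewrite /V mulrA; apply: le_trans fJ; apply: f_mono => //; exact: ltW.
have cK0 : 0 < c * K by rewrite mulr_gt0.
(* From [exp (- z) <= 2 / z^2] with [z = c K 2^j / 32]: the factor [4^-j] against the level
   [2^(j+1)] leaves the ratio [1/2]. *)
pose A := 4 * E * K * expR 16^-1 * (32 / (c * K)) ^+ 2.
have A0 : 0 <= A.
  have EK4 := mulr_ge0 (mulr_ge0 (ler0n R 4) (ltW E0)) (ltW K0).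
  exact: mulr_ge0 (mulr_ge0 EK4 (expR_ge0 _)) (sqr_ge0 _).
have term (j : nat) : V j.+1 * expR (16^-1 - c * (K * 2 ^+ j) / 32) <= A * 2^-1 ^+ j.
  have z0 : 0 < c * (K * 2 ^+ j) / 32 by rewrite divr_gt0// mulr_gt0// mulr_gt0// exprn_gt0.
  rewrite expRD; have := expRN_le_fact 1 z0.
  rewrite -(ler_pM2l (expR_gt0 16^-1)) => h.
  apply: le_trans (ler_wpM2l (V0 _) h) _.
  rewrite le_eqVlt; apply/orP; left; apply/eqP.
  have p0 : (2 : R) ^+ j != 0 by rewrite gt_eqF// exprn_gt0.
  rewrite (_ : 2`! = 2)%N// /V /A exprS exprVn; field.
  by rewrite p0 !gt_eqF.
have mG (j : 'I_J) : mean_le P (fun w => V j.+1 * G j w) (A * 2^-1 ^+ j).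
  have [_ _ mj] := GP j.
  by apply: mean_le_weaken (mean_leZ (V0 _) mj).
have := mean_leD (mean_le_cst (P := P) (V0 0%N)) (mean_le_sum (index_enum 'I_J) mG).
apply: mean_le_weaken => //.
apply: (@le_trans _ _ (V 0%N + A * 2)).
  by rewrite lerD2l -mulr_sumr ler_wpM2l// sum_half_powers.
by rewrite /V /A expr0 le_eqVlt; apply/orP; left; apply/eqP; ring.
Qed.

Definition filter_mass_const : R := betam * cA `^ s^-1 / 2.

Let cAs_le1 : cA `^ s^-1 <= 1.
Proof.
have one r : 1 `^ r = 1 :> R by rewrite powR1.
rewrite -[leRHS](one s^-1) ge0_ler_powR ?nnegrE ?invr_ge0 ?(ltW s0) ?ler01//.
  by apply: ltW; case/andP: cA_bnd.
by case/andP: cA_bnd.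
Qed.

(** The squared filter mass at [ti] is [C0 sqrt D]. A later [ti] would push it above this value,
    through the third hypothesis when the index count is below [D] and through the fourth when it
    saturates at [D]. *)
Lemma initial_time_le M : 0 < M -> 1 <= cA `^ s^-1 * (M * xs) ->
  2 * C0 <= betam ^+ 2 * cA `^ s^-1 * M * c -> 2 * C0 < betam ^+ 2 * sD ->
  ti <= (M * xs) `^ s.
Proof.
move=> M0 Mx MC0 sDC; rewrite leNgt; apply/negP => lt_ti.
have cA0 : 0 < cA `^ s^-1 by rewrite powR_gt0//; case/andP: cA_bnd.
pose x := ti `^ s^-1; have x0 : 0 < x by rewrite powR_gt0.
have tiE : ti = x `^ s by rewrite /x -powRrM mulVf ?gt_eqF// powRr1 ?ltW.
have Mxs0 : 0 < M * xs by rewrite mulr_gt0.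
have xM : M * xs < x.
  rewrite ltNge; apply/negP => xM; move: lt_ti; rewrite ltNge => /negP; apply.
  by rewrite tiE ge0_ler_powR ?nnegrE ?(ltW s0) ?(ltW x0) ?(ltW Mxs0).
have rho0 : 0 <= rho by apply/ltW/(lt_trans ltr01).
have hg i : betam * Num.min ((x `^ s * lam 0 i) `^ rho) 1 <= gam ti 0 i.
  have l01 : 0 < lam 0 i <= 1 by rewrite lam0 spectrum_le1.
  by rewrite [gam _ 0 i]mxE -tiE; have /andP[] := regR3 gR (lexx ti) l01.
have h1 : 1 <= cA `^ s^-1 * x.
  by apply: le_trans Mx _; rewrite ler_pM2l// ltW.
have := sum_expr_filter_ge cA_bnd p_gt0 d_gt0 2 x0 betam_gt0 rho0 hg h1 D_gt0.
have [_ ->] := tiP.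
have b20 : 0 < betam ^+ 2 by rewrite exprn_gt0.
case: (leP (cA `^ s^-1 * x) D%:R) => _ h.
  have a0 : 0 < betam ^+ 2 * cA `^ s^-1 by rewrite mulr_gt0.
  have e1 : betam ^+ 2 * cA `^ s^-1 * (M * xs) < betam ^+ 2 * cA `^ s^-1 * x.
    by rewrite ltr_pM2l.
  have e2 : betam ^+ 2 * cA `^ s^-1 * M * (c * sD) <= betam ^+ 2 * cA `^ s^-1 * M * xs.
    by rewrite ler_pM2l// mulr_gt0.
  have e3 : 2 * C0 * sD <= betam ^+ 2 * cA `^ s^-1 * M * c * sD by rewrite ler_pM2r.
  lra.
have e1 : 2 * C0 * sD < betam ^+ 2 * sD * sD by rewrite ltr_pM2r.
have e2 : betam ^+ 2 * (sD * sD) = betam ^+ 2 * D%:R by rewrite -expr2 sD2.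
lra.
Qed.

(** * Stochastic error at the stopping time *)

Section Variance.
Context (M : R).
Hypotheses (M_ge1 : 1 <= M) (M_resolved : 1 <= cA `^ s^-1 * (M * xs)).
Hypothesis M_time : ti <= (M * xs) `^ s.
Hypothesis M_large : 2 * (2 * weak_bias_const + Ckappa / c) <= filter_mass_const * M.

Let M0 : 0 < M. Proof. exact: lt_le_trans M_ge1. Qed.
Let cA0 : 0 < cA. Proof. by case/andP: cA_bnd. Qed.
Let c10 : 0 < filter_mass_const. Proof. by rewrite divr_gt0// mulr_gt0// powR_gt0. Qed.
Let Cb0 : 0 <= weak_bias_const.
Proof. by rewrite mulr_ge0 ?powR_ge0// le_max ler01. Qed.

Let ti_le y : M <= y -> ti <= (y * xs) `^ s.
Proof.
move=> My; apply: le_trans M_time _; have y0 := lt_le_trans M0 My.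
by rewrite ge0_ler_powR ?nnegrE ?(ltW s0) ?mulr_ge0 ?(ltW y0) ?(ltW M0) ?(ltW xs0)// ler_pM2r.
Qed.

(** At time [(y xs)^s] the filters have removed noise energy of order [delta^2 y xs] from the
    residual, more than the weak bias and the tolerance of the threshold put back. The condition
    [y xs < D] keeps the index count from saturating. *)
Lemma stopping_time_tail y : M <= y -> y * xs < D%:R ->
  exists G : T -> R, [/\ forall w, 0 <= G w,
    forall w, (y * xs) `^ s < tau w -> 1 <= G w &
    mean_le P G (expR (16^-1 - c * filter_mass_const * y / 16))].
Proof.
move=> My yD; have y0 := lt_le_trans M0 My; have y1 := le_trans M_ge1 My.
set t := (y * xs) `^ s; have tit : ti <= t by exact: ti_le.
have t0 : 0 < t by exact: lt_le_trans tit.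
pose G w := expR (1 / (8 * delta ^+ 2 * sD) * (residual2 gam t (Y w) - kappa)).
have := @mean_exp_residual R _ _ P D eps indep normal cA p d delta kappa mu
  delta_gt0 D_gt0 gam t 1 (fun i => gam01 i (ltW t0)) (normr1 R).
move=> GE; exists G; split.
- by move=> w; exact: expR_ge0.
- move=> w tw; rewrite /G -[leLHS]expR0 ler_expR mulr_ge0//.
    by rewrite ltW// divr_gt0// !mulr_gt0.
  rewrite subr_ge0 leNgt; apply/negP => rk.
  have := stopping_time_le (delta := delta) (C0 := C0) (kappa := kappa) tit (ltW rk).
  by rewrite leNgt tw.
- apply: mean_le_weaken GE => //; rewrite ler_expR.
  set F := _ / delta ^+ 2; set V := \sum_i _.
  have FE : F <= weak_bias_const * xs.
    have tst : ts <= t.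
      have xy : xs <= y * xs by rewrite ler_peMl// ltW.
      have yx0 : 0 < y * xs by rewrite mulr_gt0.
      by apply: (ge0_ler_powR (ltW s0)) => //; rewrite nnegrE ltW.
    have pw : t `^ (- (2 + 2 * theta)) <= ts `^ (- (2 + 2 * theta)).
      have e0 : 0 <= 2 + 2 * theta by rewrite addr_ge0// mulr_ge0.
      rewrite [leLHS]powRN [leRHS]powRN.
      rewrite lef_pV2 ?posrE; [|exact: powR_gt0..].
      by apply: ge0_ler_powR => //; rewrite nnegrE ltW.
    rewrite /F ler_pdivrMr//; apply: le_trans (f_le tit) _.
    have -> : weak_bias_const * xs * delta ^+ 2 = weak_bias_const * (delta ^+ 2 * xs).
      by ring.
    rewrite -radius_critical_time; apply: ler_wpM2l Cb0 _ _ _.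
    by apply: ler_wpM2l pw; exact: sqr_ge0.
  have gE : filter_mass_const * (y * xs) <= \sum_i gam t 0 i.
    have yxs0 : 0 < y * xs by rewrite mulr_gt0.
    have rho0 : 0 <= rho by apply/ltW/(lt_trans ltr01).
    have hg i : betam * Num.min ((t * lam 0 i) `^ rho) 1 <= gam t 0 i.
      have l01 : 0 < lam 0 i <= 1 by rewrite lam0 spectrum_le1.
      by rewrite [gam _ 0 i]mxE; have /andP[] := regR3 gR tit l01.
    have My' : M * xs <= y * xs by rewrite ler_pM2r.
    have h1 : 1 <= cA `^ s^-1 * (y * xs).
      by apply: le_trans M_resolved _; rewrite ler_wpM2l ?powR_ge0.
    have := sum_expr_filter_ge cA_bnd p_gt0 d_gt0 1 yxs0 betam_gt0 rho0 hg h1 D_gt0.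
    rewrite min_l; last first.
      apply: le_trans (ltW yD); rewrite ler_piMl// ltW//.
    by rewrite expr1 /filter_mass_const => h; apply: le_trans h; rewrite le_eqVlt; apply/orP; left;
      apply/eqP; ring.
  have VE : V <= D%:R - \sum_i gam t 0 i.
    have -> : D%:R - \sum_i gam t 0 i = \sum_i (1 - gam t 0 i).
      by rewrite sumrB sumr_const card_ord.
    apply: ler_sum => i _; have /andP[h0 h1] := gam01 i (ltW t0); nra.
  have [kD _] := kappa_bounds.
  have sV : 0 < sD^-1 by rewrite invr_gt0.
  have xsD : c <= xs * sD^-1 by rewrite ler_pdivlMr.
  have sV1 : sD^-1 <= 1 by rewrite invf_le1.
  have F0 : 0 <= F.
    rewrite divr_ge0 ?(ltW del20)//; apply: sumr_ge0 => i _.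
    exact: mulr_ge0 (sqr_ge0 _) (sqr_ge0 _).
  have hK : (2 * weak_bias_const + Ckappa / c) * xs <= filter_mass_const * y / 2 * xs.
    rewrite ler_pM2r//; have : filter_mass_const * M <= filter_mass_const * y by rewrite ler_pM2l.
    have := M_large; lra.
  (* The extra [F / 2] pays for the second order term [F / (16 D)]. *)
  have e1 : F + V - kappa / delta ^+ 2 + F / 2 <= - (filter_mass_const * y * xs / 2) by lra.
  have e2 : sD^-1 * (F + V - kappa / delta ^+ 2 + F / 2) <=
      sD^-1 * (- (filter_mass_const * y * xs / 2)) by rewrite ler_pM2l.
  have e3 : c * (filter_mass_const * y) <= xs * sD^-1 * (filter_mass_const * y) by rewrite ler_pM2r// mulr_gt0.
  have e4 : F * sD^-1 * sD^-1 <= F * sD^-1.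
    by rewrite ler_piMr// mulr_ge0 ?(ltW sV).
  have -> : 1 / (8 * sD) = sD^-1 / 8 by rewrite invfM mul1r mulrC.
  have -> : F / (16 * D%:R) = F * sD^-1 * sD^-1 / 16.
    have Di : D%:R^-1 = sD^-1 * sD^-1 by rewrite -invfM -expr2 sD2.
    by rewrite invfM Di; ring.
  lra.
Qed.

(** One summand for each regime: effective dimension below [D], and filters replaced by 1. *)
Definition amplitude_const : R := (1 + betap ^+ 2) * min_powR_const (s * (2 * rho - 2)) + cA^-1 ^+ 2.

(* Once [M 2^j xs] exceeds [D], the filter is replaced by its upper bound 1. *)
Let amplitude j i : R :=
  (if D%:R <= M * 2 ^+ j * xs then 1 else gam ((M * 2 ^+ j * xs) `^ s) 0 i ^+ 2) *
  (lam 0 i)^-1 ^+ 2.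

Let le_M_pow2 j : M <= M * 2 ^+ j.
Proof. by rewrite ler_peMr ?(ltW M0)// exprn_ege1// ler1n. Qed.

Let amplitude_ge0 j i : 0 <= amplitude j i.
Proof. by apply: mulr_ge0 (sqr_ge0 _); case: ifP => // _; exact: sqr_ge0. Qed.

Let sum_amplitude_le j (x := M * 2 ^+ j * xs) :
  \sum_i amplitude j i <= amplitude_const * (x * (x `^ s) ^+ 2).
Proof.
have x0 : 0 < x by rewrite !mulr_gt0// exprn_gt0.
have tx : ti <= x `^ s by apply: ti_le; exact: le_M_pow2.
have rhs0 : 0 <= x * (x `^ s) ^+ 2 by exact: mulr_ge0 (ltW x0) (sqr_ge0 _).
have kmin0 : 0 <= (1 + betap ^+ 2) * min_powR_const (s * (2 * rho - 2)).
  apply: mulr_ge0; first exact: addr_ge0 ler01 (sqr_ge0 _).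
  by rewrite divr_ge0 ?powR_ge0// subr_ge0 ltW.
rewrite /amplitude -/x; have [Dx|_] := leP D%:R x.
  apply: (@le_trans _ _ (cA^-1 ^+ 2 * (x * (x `^ s) ^+ 2))); last first.
    by rewrite ler_wpM2r// lerDr.
  have -> : cA^-1 ^+ 2 * (x * (x `^ s) ^+ 2) = x * (cA^-1 * x `^ s) ^+ 2 by ring.
  apply: (@le_trans _ _ (\sum_(i < D) (cA^-1 * x `^ s) ^+ 2)); last first.
    rewrite sumr_const card_ord -[leLHS]mulr_natl ler_wpM2r//; exact: sqr_ge0.
  apply: ler_sum => i _; rewrite mul1r lerXn2r ?nnegrE ?invr_ge0 ?(ltW (lam0 i))//.
    by rewrite mulr_ge0 ?powR_ge0// invr_ge0 ltW.
  rewrite mxE invfM ler_wpM2l ?invr_ge0 ?(ltW cA0)// powRN invrK.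
  rewrite ge0_ler_powR ?nnegrE ?(ltW s0) ?ler0n ?(ltW x0)//.
  by apply: le_trans Dx; rewrite ler_nat.
apply: (@le_trans _ _ ((1 + betap ^+ 2) * min_powR_const (s * (2 * rho - 2)) *
    (x * (x `^ s) ^+ 2))); last first.
  by rewrite ler_wpM2r// lerDl; exact: sqr_ge0.
apply: (sum_filter_amplified_le cA_bnd p_gt0 d_gt0 x0 betap_gt0 rho_gt1 _ _ srho2).
  by move=> i; have /andP[] := gam01 i (powR_ge0 x s).
move=> i; have l01 : 0 < lam 0 i <= 1 by rewrite lam0 spectrum_le1.
by rewrite [gam _ 0 i]mxE; have /andP[] := regR3 gR tx l01.
Qed.

Definition variance_term t w : R := delta ^+ 2 *
  \sum_i gam t 0 i ^+ 2 * (lam 0 i)^-1 ^+ 2 * eps i w ^+ 2.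

Let majorant j w : R := delta ^+ 2 * \sum_i amplitude j i * eps i w ^+ 2.

Let majorant_lt j w : majorant j w < variance_term (tau w) w ->
  M * 2 ^+ j * xs < D%:R /\ (M * 2 ^+ j * xs) `^ s < tau w.
Proof.
set x := M * 2 ^+ j * xs => lt1; have tau0 : 0 <= tau w := le_trans (ltW ti_gt0) (tau_ge w).
have key : (forall i, gam (tau w) 0 i ^+ 2 <=
    (if D%:R <= x then 1 else gam (x `^ s) 0 i ^+ 2)) -> False.
  move=> h; move: lt1; rewrite ltNge => /negP; apply.
  rewrite ler_pM2l//; apply: ler_sum => i _.
  by apply: ler_wpM2r (sqr_ge0 _) _ _ _; apply: ler_wpM2r (sqr_ge0 _) _ _ _; exact: h.
have Dx : x < D%:R.
  rewrite ltNge; apply/negP => Dx; apply: key => i; rewrite Dx.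
  by have /andP[h0 h1] := gam01 i tau0; rewrite exprn_ile1.
split=> //; rewrite ltNge; apply/negP => tx; apply: key => i.
rewrite (lt_geF Dx); have /andP[h0 h1] := gam01 i tau0.
have h := filter_nondecreasing gR lam0 i tau0 tx.
by rewrite lerXn2r ?nnegrE// (le_trans h0).
Qed.

(** [b] is the growth of [x (x^s)^2] when [x] doubles, and [Q] the constant in the polynomial bound
    of order [2 N] on the tails of [tau]. *)
Lemma mean_variance_term (N : nat) : 2 + 2 * s <= N%:R ->
  let b := 2 * (2 `^ s) ^+ 2 in
  let Q := expR 16^-1 * ((2 * N)`!%:R / (c * filter_mass_const * M / 16) ^+ (2 * N)) in
  mean_le P (fun w => variance_term (tau w) w)
    (amplitude_const * (M * (M `^ s) ^+ 2) *
     (4 * expR 2^-1 + b * (Q + 32 * expR 2^-1)) * (delta ^+ 2 * (xs * ts ^+ 2))).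
Proof.
move=> Ns b Q.
have N0 : (0 < N)%N by rewrite -(ltr_nat R) (lt_le_trans _ Ns)// ltr_wpDr// mulr_ge0// ltW.
have b0 : 0 < b by rewrite mulr_gt0// exprn_gt0// powR_gt0.
(* The choice of [N] gives [2 b = 2^(2 + 2 s) <= e], so weights [e^-j] against amplitudes [b^j]
   leave the ratio [1/2]. *)
pose e : R := 2 ^+ N; have e0 : 0 < e by rewrite exprn_gt0.
have be : b <= e / 2.
  have bE : b * 2 = 2 `^ (2 + 2 * s).
    have -> : 2 + 2 * s = s * 2 + (1 + 1) by ring.
    have two0 : (2 == 0 :> R) = false by rewrite gt_eqF.
    rewrite powRD ?two0 ?implybT// powRD ?two0 ?implybT// powRrM powRr1//.
    by rewrite powR_mulrn ?powR_ge0// /b; ring.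
  rewrite ler_pdivlMr// bE /e -powR_mulrn//.
  by rewrite ler_powR// ler1n.
have E0 : 0 <= delta ^+ 2 * (xs * ts ^+ 2).
  by apply: mulr_ge0 (ltW del20) (mulr_ge0 (ltW xs0) (sqr_ge0 _)).
pose A := M * (M `^ s) ^+ 2 * (xs * ts ^+ 2).
have xE j (x := M * 2 ^+ j * xs) : x * (x `^ s) ^+ 2 = A * b ^+ j.
  have pj0 : 0 <= (2 : R) ^+ j by rewrite exprn_ge0.
  have pE : ((2 : R) ^+ j) `^ s = (2 `^ s) ^+ j.
    by rewrite powR_exprn.
  have -> : x `^ s = M `^ s * (2 `^ s) ^+ j * ts.
    rewrite /x [(M * 2 ^+ j * xs) `^ s]powRM ?(ltW xs0) ?(mulr_ge0 (ltW M0) pj0)//.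
    by rewrite [(M * 2 ^+ j) `^ s]powRM ?(ltW M0)// pE.
  by rewrite /x /A /b [(2 * _) ^+ j]exprMn [((2 `^ s) ^+ 2) ^+ j]exprAC; ring.
have K20 : 0 <= amplitude_const.
  apply: addr_ge0 (sqr_ge0 _); apply: mulr_ge0.
    exact: addr_ge0 ler01 (sqr_ge0 _).
  by rewrite divr_ge0 ?powR_ge0// subr_ge0 ltW.
have tail j : exists G : T -> R, [/\ forall w, 0 <= G w,
    forall w, M * 2 ^+ j * xs < D%:R -> (M * 2 ^+ j * xs) `^ s < tau w -> 1 <= G w &
    mean_le P G (expR (16^-1 - c * filter_mass_const * (M * 2 ^+ j) / 16))].
  have [Dx|xD] := leP D%:R (M * 2 ^+ j * xs).
    exists (cst 0); split=> //.
    by apply: mean_le_weaken (mean_le_cst (lexx 0)) => //; exact: expR_ge0.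
  by have [G [G0 G1 GE]] := stopping_time_tail (le_M_pow2 j) xD; exists G; split=> // w _; exact: G1.
have [G GP] := choice tail.
(* The amplitudes grow like [2^(j(1+2s))] and the tail probabilities decay like
   [4^(-jN)], so that this AM-GM weight makes the dyadic sum geometric. *)
pose eta j : R := e^-1 ^+ j.
have eta0 j : 0 < eta j by rewrite exprn_gt0// invr_gt0.
pose W j w := delta ^+ 2 * \sum_i amplitude j.+1 i *
  (((eta j)^-1 * G j w + eta j * eps i w ^+ 4) / 2).
(* At level [J] the filters are replaced by 1, so the majorant holds whatever [tau] is, and the
   chain of levels ends. *)
have [J DJ] := exists_le_pow2 D%:R (mulr_gt0 M0 xs0).
have sq4 (x : R) : x ^+ 4 = (x ^+ 2) ^+ 2 by rewrite -exprM.
have pathwise w : variance_term (tau w) w <= majorant 0 w + \sum_(j < J) W j w.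
  apply: (le_dyadic (V := fun j => majorant j w) (W := fun j => W j w)).
  - apply: mulr_ge0 (ltW del20) _; apply: sumr_ge0 => i _.
    exact: mulr_ge0 (amplitude_ge0 _ _) (sqr_ge0 _).
  - move=> j; apply: mulr_ge0 (ltW del20) _; apply: sumr_ge0 => i _.
    apply: mulr_ge0 (amplitude_ge0 _ _) _; rewrite divr_ge0// addr_ge0//.
      by have [G0 _ _] := GP j; rewrite mulr_ge0// invr_ge0 ltW.
    by rewrite sq4; exact: mulr_ge0 (ltW (eta0 j)) (sqr_ge0 _).
  - move=> j /majorant_lt[xD xtau]; have [_ G1 _] := GP j.
    rewrite ler_pM2l//; apply: ler_sum => i _; rewrite ler_wpM2l//.
    have Gw := G1 w xD xtau; rewrite ler_pdivlMr//.
    (* AM-GM: [2 eps^2 <= 1 / eta + eta eps^4] *)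
    apply: (@le_trans _ _ ((eta j)^-1 * 1 + eta j * eps i w ^+ 4)); last first.
      by rewrite lerD2r ler_wpM2l// invr_ge0 ltW.
    have := mulr_ge0 (ltW (eta0 j)) (sqr_ge0 ((eta j)^-1 - eps i w ^+ 2)).
    have -> : eta j * ((eta j)^-1 - eps i w ^+ 2) ^+ 2 =
      (eta j)^-1 * 1 + eta j * eps i w ^+ 4 - eps i w ^+ 2 * 2.
      by field; rewrite gt_eqF.
    by rewrite subr_ge0.
  - rewrite leNgt; apply/negP => /majorant_lt[]; rewrite ltNge => /negP + _; apply.
    by apply: le_trans DJ _; rewrite mulrAC.
have sumA j : \sum_i amplitude j i <= amplitude_const * A * b ^+ j.
  have := sum_amplitude_le j => /=; rewrite xE [_ * (A * _)]mulrA; exact.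
have mean0 : mean_le P (majorant 0) (delta ^+ 2 * (amplitude_const * A * (4 * expR 2^-1))).
  apply: mean_leZ (ltW del20) _.
  have := mean_le_sum (index_enum 'I_D)
    (fun i => mean_leZ (amplitude_ge0 0 i) (mean_sqr_normal normal i)).
  apply: mean_le_weaken => //; rewrite -mulr_suml ler_wpM2r ?mulr_ge0 ?expR_ge0//.
  by have := sumA 0%N; rewrite expr0 mulr1.
pose B := delta ^+ 2 * (amplitude_const * A * b * ((Q + 32 * expR 2^-1) / 2)).
have cM0 : 0 < c * filter_mass_const * M.
  exact: mulr_gt0 (mulr_gt0 c_gt0 c10) M0.
have z0 : 0 < c * filter_mass_const * M / 16 by rewrite divr_gt0.
have Q0 : 0 <= Q.
  apply: mulr_ge0 (expR_ge0 _) (divr_ge0 (ler0n _ _) (exprn_ge0 _ (ltW z0))).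
have A0 : 0 <= A.
  have := mulr_ge0 (mulr_ge0 (ltW M0) (sqr_ge0 (M `^ s))) (mulr_ge0 (ltW xs0) (sqr_ge0 ts)).
  by [].
have meanW j : mean_le P (W j) (B * 2^-1 ^+ j).
  have [_ _ GE] := GP j.
  set pj := expR _ in GE.
  (* The tail is at most [Q e^(-2 j)]; one factor [e^j] is spent on [1 / eta j]. *)
  have pQ : (eta j)^-1 * pj <= Q * e^-1 ^+ j.
    have zj0 : 0 < c * filter_mass_const * (M * 2 ^+ j) / 16.
      by rewrite mulrA mulrAC mulr_gt0// exprn_gt0.
    have := expRN_le_fact (2 * N).-1 zj0; rewrite prednK ?muln_gt0// => h.
    rewrite /pj expRD.
    rewrite -(ler_pM2l (expR_gt0 16^-1)) -(ler_pM2l (x := (eta j)^-1)) ?invr_gt0// in h.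
    apply: le_trans h _; rewrite le_eqVlt; apply/orP; left; apply/eqP.
    rewrite /Q /eta !exprVn invrK.
    have -> : c * filter_mass_const * (M * 2 ^+ j) / 16 = c * filter_mass_const * M / 16 * 2 ^+ j by ring.
    have -> : (c * filter_mass_const * M / 16 * 2 ^+ j) ^+ (2 * N) =
        (c * filter_mass_const * M / 16) ^+ (2 * N) * (e ^+ j * e ^+ j).
      rewrite exprMn; congr (_ * _); rewrite /e -!exprM -exprD; congr (_ ^+ _).
      by rewrite mulnC -mulnA mul2n addnn.
    have ej0 : e ^+ j != 0 by rewrite gt_eqF// exprn_gt0.
    have zN0 : (c * filter_mass_const * M / 16) ^+ (2 * N) != 0 by rewrite gt_eqF// exprn_gt0.
    by field; rewrite ej0 zN0.
  have coord i : mean_le P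
      (fun w => amplitude j.+1 i * (((eta j)^-1 * G j w + eta j * eps i w ^+ 4) / 2))
      (amplitude j.+1 i * ((Q + 32 * expR 2^-1) / 2 * e^-1 ^+ j)).
    apply: mean_leZ (amplitude_ge0 _ _) _.
    have etaV0 : 0 <= (eta j)^-1 by rewrite invr_ge0 ltW.
    have := mean_leZ (ler0n R 1) (mean_leD (mean_leZ etaV0 GE)
      (mean_leZ (ltW (eta0 j)) (mean_expr4_normal normal i))).
    move=> /(mean_leZ (k := 2^-1)); rewrite invr_ge0 => /(_ (ler0n _ _)).
    apply: mean_le_weaken => [w|]; first by rewrite mul1r mulrC.
    by move: pQ; rewrite -/(eta j); lra.
  have := mean_leZ (ltW del20) (mean_le_sum (index_enum 'I_D) coord).
  apply: mean_le_weaken => //; rewrite -mulr_suml.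
  set q0 := (Q + 32 * expR 2^-1) / 2.
  have q00 : 0 <= q0 by rewrite divr_ge0// addr_ge0// mulr_ge0// expR_ge0.
  have ej0 : 0 <= e^-1 ^+ j by rewrite exprn_ge0// invr_ge0 ltW.
  apply: (@le_trans _ _ (delta ^+ 2 * (amplitude_const * A * b ^+ j.+1 * (q0 * e^-1 ^+ j)))).
    rewrite ler_pM2l// ler_wpM2r//; first exact: mulr_ge0.
  have KAbq : 0 <= delta ^+ 2 * (amplitude_const * A * b * q0).
    apply: mulr_ge0 (ltW del20) (mulr_ge0 _ q00).
    exact: mulr_ge0 (mulr_ge0 K20 A0) (ltW b0).
  have -> : delta ^+ 2 * (amplitude_const * A * b ^+ j.+1 * (q0 * e^-1 ^+ j)) =
      delta ^+ 2 * (amplitude_const * A * b * q0) * (b * e^-1) ^+ j.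
    rewrite [b ^+ j.+1]exprS [(b * _) ^+ j]exprMn.
    by move: (b ^+ j) (e^-1 ^+ j) => u v; ring.
  have be0 : 0 <= b * e^-1 by rewrite divr_ge0 ?ltW.
  have be2 : b * e^-1 <= 2^-1 by rewrite ler_pdivrMr// mulrC.
  by rewrite /B -/q0 ler_wpM2l// lerXn2r ?nnegrE// invr_ge0.
have := mean_leD mean0 (mean_le_sum (index_enum 'I_J) (fun j => meanW j)).
apply: mean_le_weaken => //.
rewrite -mulr_sumr.
have B0 : 0 <= B.
  have q00 : 0 <= (Q + 32 * expR 2^-1) / 2.
    by rewrite divr_ge0// addr_ge0// mulr_ge0// expR_ge0.
  exact: mulr_ge0 (ltW del20) (mulr_ge0 (mulr_ge0 (mulr_ge0 K20 A0) (ltW b0)) q00).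
apply: (@le_trans _ _ (delta ^+ 2 * (amplitude_const * A * (4 * expR 2^-1)) + B * 2)).
  by rewrite lerD2l ler_wpM2l// sum_half_powers.
by rewrite /B /A le_eqVlt; apply/orP; left; apply/eqP; field.
Qed.

(** The filter at [tau w] depends on the noise, so the cross term need not be centred; it is
    absorbed by the factors 2. *)
Lemma loss_le w : enorm (estimator lam gam (tau w) (Y w) - mu) ^+ 2 <=
  2 * strong_bias2 mu (gam (tau w)) + 2 * variance_term (tau w) w.
Proof.
rewrite sqr_sqrtr; last by apply: sumr_ge0 => i _; exact: sqr_ge0.
rewrite /strong_bias2 /variance_term !mulr_sumr -big_split/=.
apply: ler_sum => i _; have l0 := lam0 i.
set t := tau w; set a := (1 - gam t 0 i) * mu 0 i.
set v := gam t 0 i * (lam 0 i)^-1 * delta * eps i w.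
have -> : (estimator lam gam t (Y w) - mu) 0 i = v - a.
  rewrite mxE [(- mu) 0 i]mxE [estimator _ _ _ _ 0 i]mxE.
  rewrite [observation _ _ _ _ 0 i]mxE [(\row_j eps j w) 0 i]mxE /v /a.
  by field; rewrite gt_eqF.
have -> : 2 * (delta ^+ 2 * (gam t 0 i ^+ 2 * (lam 0 i)^-1 ^+ 2 * eps i w ^+ 2)) =
    2 * v ^+ 2 by rewrite /v; ring.
have := sqr_ge0 (v + a); lra.
Qed.

Lemma mean_loss K (N : nat) :
  weak_bias_const <= K -> 4 * (2 * filter_sum_const + Ckappa / c) <= K -> 0 < K ->
  2 + 2 * s <= N%:R ->
  mean_le P (fun w => enorm (estimator lam gam (tau w) (Y w) - mu) ^+ 2)
    (2 * (K * (1 + 8 * expR 16^-1 * (32 / (c * K)) ^+ 2) + cA `^ (- (2 * theta)) +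
      amplitude_const * (M * (M `^ s) ^+ 2) *
      (4 * expR 2^-1 + 2 * (2 `^ s) ^+ 2 *
        (expR 16^-1 * ((2 * N)`!%:R / (c * filter_mass_const * M / 16) ^+ (2 * N))
         + 32 * expR 2^-1)))
     * (delta ^+ 2 * (xs * ts ^+ 2))).
Proof.
move=> hK1 hK2 K0 hN.
have bias := mean_leZ (mulr_ge0 (ler0n R 2) (sqr_ge0 ts)) (mean_weak_bias hK1 hK2 K0).
have var := mean_leZ (ler0n R 2) (mean_variance_term hN).
have r0 : 0 <= 2 * (ts `^ (- (2 * theta)) * (cA `^ (- (2 * theta)) * radius ^+ 2)).
  exact: mulr_ge0 (ler0n _ _) (mulr_ge0 (powR_ge0 _ _) (mulr_ge0 (powR_ge0 _ _) (sqr_ge0 _))).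
apply: mean_le_weaken (mean_leD (mean_leD bias (mean_le_cst r0)) var) => [w|].
  apply: le_trans (loss_le w) _; rewrite lerD2r /=.
  have := strong_bias_le cA_bnd p_gt0 d_gt0 beta_ge0 mu_ell
    (fun i => gam01 i (le_trans (ltW ti_gt0) (tau_ge w))) ts0.
  move=> h; apply: le_trans (ler_wpM2l (ler0n R 2) h) _.
  by rewrite [leLHS]mulrDr [2 * (ts ^+ 2 * _)]mulrA.
(* By the critical balance, the source term of the strong bias is exactly of the order of the
   rate. *)
have rE : radius ^+ 2 * ts `^ (- (2 * theta)) = delta ^+ 2 * (xs * ts ^+ 2).
  rewrite [RHS]mulrA -radius_critical_time -[RHS]mulrA; congr (_ * _).
  rewrite -powR_mulrn ?(ltW ts0)// -powRD; last by rewrite (gt_eqF ts0) implybT.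
  by congr (_ `^ _); ring.
rewrite le_eqVlt; apply/orP; left; apply/eqP.
have -> : ts `^ (- (2 * theta)) * (cA `^ (- (2 * theta)) * radius ^+ 2) =
  cA `^ (- (2 * theta)) * (delta ^+ 2 * (xs * ts ^+ 2)) by rewrite -rE; ring.
ring.
Qed.

End Variance.
End NoiseLevel.

(** With [L = radius / delta], both sides are [delta^2] times a power of [L], and
    [(2 d + 4 p) / m = 2 - 4 beta / m]. *)
Lemma minimax_rateE (R : realType) (radius beta p delta : R) (d : nat) :
  0 < radius -> 0 <= beta -> 0 < p -> (0 < d)%N -> 0 < delta ->
  let m := 2 * beta + 2 * p + d%:R in
  let xs := (radius / delta) `^ (2 * d%:R / m) in
  delta ^+ 2 * (xs * (xs `^ (p / d%:R)) ^+ 2) =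
  radius ^+ 2 * (radius^-1 * delta) `^ (4 * beta / m).
Proof.
move=> r0 b0 p0 d0 del0 m xs.
have dR0 : 0 < d%:R :> R by rewrite ltr0n.
have m0 : m != 0 by apply: lt0r_neq0; rewrite /m; lra.
rewrite /xs; clear xs; set L := radius / delta; have L0 : 0 < L by rewrite divr_gt0.
have -> : radius^-1 * delta = L `^ (- 1).
  by rewrite powR_inv1 ?(ltW L0)// /L invf_div mulrC.
have rE : radius = delta * L by rewrite /L mulrC divfK// gt_eqF.
have -> : radius ^+ 2 = delta ^+ 2 * L ^+ 2 by rewrite rE exprMn.
rewrite -[RHS]mulrA; congr (_ * _).
set a := 2 * d%:R / m.
have -> : (L `^ a `^ (p / d%:R)) ^+ 2 = L `^ (a * (p / d%:R) * 2).
  by rewrite -powR_mulrn ?powR_ge0// -!powRrM ?mulrA.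
have -> : L ^+ 2 = L `^ 2 by rewrite powR_mulrn// ltW.
rewrite -powRrM -!powRD ?(gt_eqF L0) ?implybT//; congr (_ `^ _).
by rewrite /a /m; field; rewrite -/m m0 gt_eqF.
Qed.

Unset Implicit Arguments.
Set Strict Implicit.

Theorem corollary3p7 (R : realType)
  (radius beta p : R) (d : nat)
  (radius_gt0 : 0 < radius) (beta_ge0 : 0 <= beta) (p_gt0 : 0 < p)
  (d_gt0 : (0 < d)%N)
  (rho betam betap Ckappa C0 cA Cq q c : R)
  (rho_gt1 : 1 < rho) (betam_gt0 : 0 < betam) (betap_gt0 : 0 < betap)
  (C0_ge1 : 1 <= C0) (Ckappa_bnd : 0 <= Ckappa < C0)
  (cA_bnd : 0 < cA <= 1)
  (p_large : (Num.min rho (2 * rho - 2))^-1 < p / d%:R)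
  (q_gt0 : 0 < q) (q_large : beta / p <= 2 * q - 1) (c_gt0 : 0 < c)
  (g : R -> R -> R) :
  exists C : R, 0 < C /\
  forall (delta : nat -> R) (D : nat -> nat) (kappa : nat -> R)
    (disp : nat -> measure_display) (T : forall n, measurableType (disp n))
    (P : forall n, probability (T n) R)
    (eps : forall n, 'I_(D n) -> {RV (P n) >-> R}),
  let lam n := power_spectrum cA p d (D n) in
  let gam n := regulariser_filter g (lam n) in
  let t0 n := initial_time (delta n) (gam n) C0 in
  (forall n, 0 < delta n) ->
  delta n @[n --> \oo] --> (0 : R) ->
  D n @[n --> \oo] --> \oo ->
  (forall n, C0 < Num.sqrt (D n)%:R) ->
  (forall n, mutually_independent (eps n)) ->
  (forall n i, standard_normal (eps n i)) ->
  (forall n, assumption_R (t0 n) rho betam betap g) ->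
  (forall n, 0 < kappa n) ->
  (forall n, `|kappa n - (D n)%:R * delta n ^+ 2|
             <= Ckappa * Num.sqrt (D n)%:R * delta n ^+ 2) ->
  (forall n (t l : R), t0 n <= t -> 0 < l <= 1 ->
     1 - g t l <= Cq * (t * l) `^ (- (2 * q))) ->
  (forall n, c * Num.sqrt (D n)%:R <=
     (radius / delta n) `^ (2 * d%:R / (2 * beta + 2 * p + d%:R))) ->
  \forall n \near \oo,
    (ereal_sup [set stopped_risk (eps n) (lam n) (delta n) (gam n) C0 (kappa n) mu
               | mu in sobolev_ellipsoid d beta radius]
     <= (C * radius ^+ 2 *
         (radius^-1 * delta n) `^ (4 * beta / (2 * beta + 2 * p + d%:R)))%:E)%E.
Proof.
have C0_gt0 : 0 < C0 by exact: lt_le_trans C0_ge1.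
have /andP[Ckappa_ge0 _] := Ckappa_bnd.
have /andP[cA_gt0 _] := cA_bnd.
have dR0 : 0 < d%:R :> R by rewrite ltr0n.
pose s := p / d%:R; have s0 : 0 < s by rewrite divr_gt0.
have min0 : 0 < Num.min rho (2 * rho - 2) by rewrite lt_min; apply/andP; split; lra.
have smin : 1 < s * Num.min rho (2 * rho - 2).
  by rewrite -ltr_pdivrMr// div1r.
have srho : 1 < s * rho.
  by apply: lt_le_trans smin _; rewrite ler_pM2l// ge_min lexx.
have srho2 : 1 < s * (2 * rho - 2).
  by apply: lt_le_trans smin _; rewrite ler_pM2l// ge_min lexx orbT.
pose Cb := weak_bias_const beta p cA Cq.
pose Ks := filter_sum_const p d rho betap.
pose cm := filter_mass_const p d betam cA.
pose Ka := amplitude_const p d rho betap cA.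
have Cb0 : 0 <= Cb by rewrite mulr_ge0 ?powR_ge0// le_max ler01.
have kmin0 (a : R) : 1 < a -> 0 <= min_powR_const a.
  by move=> a1; rewrite divr_ge0 ?powR_ge0// subr_ge0 ltW.
have Ks0 : 0 <= Ks by rewrite mulr_ge0 ?kmin0// addr_ge0// ltW.
have cm0 : 0 < cm by rewrite divr_gt0// mulr_gt0// powR_gt0.
have Ka0 : 0 <= Ka.
  have kb := mulr_ge0 (addr_ge0 ler01 (sqr_ge0 betap)) (kmin0 _ srho2).
  exact: addr_ge0 kb (sqr_ge0 cA^-1).
have Ckc0 : 0 <= Ckappa / c by rewrite divr_ge0 ?(ltW c_gt0).
pose cAs := cA `^ s^-1; have cAs0 : 0 < cAs by rewrite powR_gt0.
have b20 : 0 < betam ^+ 2 by rewrite exprn_gt0.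
pose K := Cb + 4 * (2 * Ks + Ckappa / c) + 1.
have K0 : 0 < K by rewrite /K; lra.
(* Three lower bounds on [M]: [m1] resolves at least one index, [m2] brings [(M xs)^s] past the
   initial time, [m3] brings the mean of the residual below the threshold. *)
pose m1 := (c * cAs)^-1; pose m2 := 2 * C0 / (betam ^+ 2 * cAs * c).
pose m3 := 2 * (2 * Cb + Ckappa / c) / cm.
have m10 : 0 <= m1 by rewrite invr_ge0 ltW// mulr_gt0.
have m20 : 0 <= m2.
  by rewrite divr_ge0//; [rewrite mulr_ge0// ltW | rewrite ltW// !mulr_gt0].
have m30 : 0 <= m3.
  by rewrite divr_ge0 ?(ltW cm0)// mulr_ge0// addr_ge0// mulr_ge0.
pose M := 1 + m1 + m2 + m3; have M1 : 1 <= M by rewrite /M; lra.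
have M0 : 0 < M by exact: lt_le_trans M1.
pose N := (Num.truncn (2 + 2 * s)).+1.
have hN : 2 + 2 * s <= N%:R by rewrite ltW// truncnS_gt.
pose C := 2 * (K * (1 + 8 * expR 16^-1 * (32 / (c * K)) ^+ 2) + cA `^ (- (2 * (beta / p))) +
      Ka * (M * (M `^ s) ^+ 2) *
      (4 * expR 2^-1 + 2 * (2 `^ s) ^+ 2 *
        (expR 16^-1 * ((2 * N)`!%:R / (c * cm * M / 16) ^+ (2 * N))
         + 32 * expR 2^-1))).
exists C; split.
  have a1 : 0 < cA `^ (- (2 * (beta / p))) by rewrite powR_gt0.
  have a2 : 0 <= K * (1 + 8 * expR 16^-1 * (32 / (c * K)) ^+ 2).
    apply: mulr_ge0 (ltW K0) (addr_ge0 ler01 (mulr_ge0 _ (sqr_ge0 _))).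
    by rewrite mulr_ge0// expR_ge0.
  have a3 : 0 <= Ka * (M * (M `^ s) ^+ 2) by exact: mulr_ge0 Ka0 (mulr_ge0 (ltW M0) (sqr_ge0 _)).
  have a4 : 0 <= expR 16^-1 * ((2 * N)`!%:R / (c * cm * M / 16) ^+ (2 * N)) + 32 * expR 2^-1.
    apply: addr_ge0 (mulr_ge0 (expR_ge0 _) (divr_ge0 (ler0n _ _) (exprn_ge0 _ _))) _.
      by rewrite ltW// divr_gt0// (mulr_gt0 (mulr_gt0 c_gt0 cm0) M0).
    by rewrite mulr_ge0// expR_ge0.
  have a5 : 0 <= 2 * (2 `^ s) ^+ 2 :> R by exact: mulr_ge0 (ler0n _ _) (sqr_ge0 _).
  have a6 := mulr_ge0 a3 (addr_ge0 (mulr_ge0 (ler0n R 4) (expR_ge0 2^-1)) (mulr_ge0 a5 a4)).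
  rewrite /C; lra.
move=> delta D kappa disp T P eps lam gam t0 delta0 _ Dy C0D indep normal gR
  kappa0 kappaD qualif xs_ge.
(* [sqrt D > r] is the saturated case in locating the initial time; it holds for large [n]. *)
pose r := 2 * C0 / betam ^+ 2.
have r0 : 0 < r by rewrite divr_gt0// mulr_gt0.
have near_D : \forall n \near \oo, ((Num.truncn (r ^+ 2)).+1 <= D n)%N.
  by move/cvgnyPge : Dy; apply.
apply: filterS near_D => n Dn.
have rD : 2 * C0 < betam ^+ 2 * Num.sqrt (D n)%:R.
  rewrite [ltRHS]mulrC -ltr_pdivrMr// -/r -[r]gtr0_norm// -sqrtr_sqr ltr_sqrt.
    by apply: lt_le_trans (truncnS_gt _) _; rewrite ler_nat.
  by rewrite ltr0n (leq_trans _ Dn).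
apply: ge_ereal_sup => _ [mu mu_ell <-].
pose xs := (radius / delta n) `^ (2 * d%:R / (2 * beta + 2 * p + d%:R)).
have sD1 : 1 <= Num.sqrt (D n)%:R :> R by exact: le_trans C0_ge1 (ltW (C0D n)).
have cxs : c <= xs by apply: le_trans (xs_ge n); rewrite ler_peMr// ltW.
have M_resolved : 1 <= cA `^ (p / d%:R)^-1 * (M * xs).
  have h : 1 <= cAs * (m1 * c).
    rewrite (_ : cAs * (m1 * c) = 1)// /m1.
    by field; rewrite !gt_eqF.
  apply: le_trans h _; rewrite ler_pM2l// ler_pM// ?(ltW c_gt0)//.
  by rewrite /M; lra.
have MC0 : 2 * C0 <= betam ^+ 2 * cA `^ (p / d%:R)^-1 * M * c.
  have bc0 : 0 < betam ^+ 2 * cAs * c by rewrite !mulr_gt0.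
  rewrite -/s -/cAs [leRHS]mulrAC [leRHS]mulrC -ler_pdivrMr//; rewrite -/m2 /M; lra.
have M_time : t0 n <= (M * xs) `^ (p / d%:R).
  exact: (initial_time_le radius_gt0 p_gt0 d_gt0 rho_gt1 betam_gt0 C0_gt0 cA_bnd
    (delta0 n) (C0D n) (gR n) (xs_ge n) M0 M_resolved MC0 rD).
have M_large : 2 * (2 * Cb + Ckappa / c) <= cm * M.
  rewrite [leRHS]mulrC -ler_pdivrMr// -/m3 /M; lra.
have CbK : Cb <= K by rewrite /K; lra.
have KsK : 4 * (2 * Ks + Ckappa / c) <= K by rewrite /K; lra.
have := mean_loss radius_gt0 beta_ge0 p_gt0 d_gt0 rho_gt1 betam_gt0 betap_gt0
  C0_gt0 Ckappa_ge0 cA_bnd q_large c_gt0 srho srho2 (delta0 n) (C0D n) (indep n)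
  (normal n) (gR n) (kappa0 n) (kappaD n) (qualif n) (xs_ge n) mu_ell M1
  M_resolved M_time M_large CbK KsK K0 hN.
rewrite -/C minimax_rateE// mulrA => loss_C.
apply: mean_le_expectation loss_C => w; exact: sqr_ge0.
Qed.
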